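(* Fix $L>4\pi$, and let $k_L$, $c(k)$ and $\phi_k$ be as defined in the context. For each $k\in(0,k_L)$, the linearized operator $$\mathcal{L}_k f=-c(k)f''+(c(k)-1)f-\frac32\phi_k^{1/2}f,$$ acting on $L^2_{per}([0,L])$ with domain $H^2_{per}([0,L])$, has a unique negative eigenvalue, which is simple.
   Context: $L^2_{per}([0,L])$ and $H^2_{per}([0,L])$ are the usual $L$-periodic Lebesgue and Sobolev spaces. $K(k)=\int_0^{\pi/2}(1-k^2\sin^2\theta)^{-1/2}d\theta$ is the complete elliptic integral of the first kind and $\mathrm{cn}(\cdot,k)$ is the Jacobi cnoidal elliptic function with modulus $k\in(0,1)$ (parameter $m=k^2$). The function $g(k)=64K^2(k)\sqrt{k^4-k^2+1}$ is strictly increasing on $(0,1)$ with $g(0)=16\pi^2$ and $g(k)\to+\infty$ as $k\to1$; for $L>4\pi$, $k_L\in(0,1)$ denotes the unique number with $g(k_L)=L^2$. For $k\in(0,k_L)$ put $$\tilde m(k)=L^2-64K^2(k)\sqrt{k^4-k^2+1},\qquad c(k)=\frac{L^2}{\tilde m(k)},$$ $$\phi_k(x)=\left[\frac{5}{12}\left(\frac{L^2-64(2k^2-1)K^2(k)}{\tilde m(k)}-1\right)+\frac{80k^2K^2(k)}{\tilde m(k)}\,\mathrm{cn}^2\!\left(\frac{2K(k)}{L}x,k\right)\right]^2 .$$ The expression inside the square brackets is positive, so $\phi_k^{1/2}$ is that expression. *)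

(* Defs.v *)
From mathcomp Require Import all_boot all_order all_algebra.
From mathcomp Require Import all_classical all_reals all_analysis.

Set Implicit Arguments.
Unset Strict Implicit.
Unset Printing Implicit Defensive.
Import Order.TTheory GRing.Theory Num.Theory.
Import numFieldNormedType.Exports.
Local Open Scope classical_set_scope.
Local Open Scope ring_scope.

(** Elliptic integrals and the cnoidal function; [k] is the modulus, so the
    parameter is [m = k ^+ 2]. *)

Definition ellip_dens (R : realType) (k t : R) : R :=
  (Num.sqrt (1 - k ^+ 2 * sin t ^+ 2))^-1.

Definition ellipK (R : realType) (k : R) : R :=
  \int[lebesgue_measure]_(t in `[0, pi / 2]) ellip_dens k t.

(** Incomplete integral of the first kind: the oriented integral from [0] to
    [x], for [x] of either sign. *)
Definition ellipF (R : realType) (k x : R) : R :=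
  if 0 <= x then \int[lebesgue_measure]_(t in `[0, x]) ellip_dens k t
  else - \int[lebesgue_measure]_(t in `[x, 0]) ellip_dens k t.

(** For [0 < k < 1] the map [ellipF k] is an increasing bijection of the real
    line; the amplitude is its inverse, so the default [0] is never used. *)
Definition jacobi_am (R : realType) (k u : R) : R :=
  xget 0 [set x | ellipF k x = u].

Definition jacobi_cn (R : realType) (u k : R) : R := cos (jacobi_am k u).

Definition gfun (R : realType) (k : R) : R :=
  64 * ellipK k ^+ 2 * Num.sqrt (k ^+ 4 - k ^+ 2 + 1).

Definition mtilde (R : realType) (L k : R) : R :=
  L ^+ 2 - 64 * ellipK k ^+ 2 * Num.sqrt (k ^+ 4 - k ^+ 2 + 1).

Definition wave_speed (R : realType) (L k : R) : R := L ^+ 2 / mtilde L k.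

Definition wave_profile (R : realType) (L k x : R) : R :=
  (5 / 12 * ((L ^+ 2 - 64 * (2 * k ^+ 2 - 1) * ellipK k ^+ 2) / mtilde L k - 1)
   + 80 * k ^+ 2 * ellipK k ^+ 2 / mtilde L k
     * jacobi_cn (2 * ellipK k / L * x) k ^+ 2) ^+ 2.

(** Elements of L^2_per([0,L]) are represented by L-periodic functions on the
    line whose restriction to a period is square-integrable; equality in
    L^2_per([0,L]) is equality almost everywhere on [0,L]. *)
Definition L2per (R : realType) (L : R) (f : R -> R) : Prop :=
  periodic f L /\ f \_ [set` `[0, L]] \in Lfun lebesgue_measure 2%:E.

Definition eq_L2per (R : realType) (L : R) (f g : R -> R) : Prop :=
  f = g %[ae lebesgue_measure in [set` `[0, L]]].

(** Test functions: [C^oo] and L-periodic. *)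
Definition smooth_per (R : realType) (L : R) (phi : R -> R) : Prop :=
  periodic phi L /\ forall (n : nat) (x : R), derivable (derive1n n phi) x 1.

(** [g] is the derivative of [f] in the sense of periodic distributions. *)
Definition weak_deriv (R : realType) (L : R) (f g : R -> R) : Prop :=
  forall phi : R -> R, smooth_per L phi ->
    \int[lebesgue_measure]_(x in `[0, L]) (f x * derive1 phi x) =
    - \int[lebesgue_measure]_(x in `[0, L]) (g x * phi x).

(** [f] is in H^2_per([0,L]), with first and second weak derivatives [f1] and
    [f2]. *)
Definition H2per (R : realType) (L : R) (f f1 f2 : R -> R) : Prop :=
  [/\ L2per L f, L2per L f1, L2per L f2, weak_deriv L f f1
    & weak_deriv L f1 f2].

(** An unbounded operator on L^2_per([0,L]) is given by its graph [A]: [A f h]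
    says that [f] lies in the domain and is mapped to [h]. *)
Definition linearized_op (R : realType) (L k : R) (f h : R -> R) : Prop :=
  L2per L h /\
  exists f1 f2 : R -> R, H2per L f f1 f2 /\
    eq_L2per L h (fun x =>
      - wave_speed L k * f2 x + (wave_speed L k - 1) * f x
      - 3 / 2 * Num.sqrt (wave_profile L k x) * f x).

Definition eigenfunction (R : realType) (L : R)
    (A : (R -> R) -> (R -> R) -> Prop) (lam : R) (f : R -> R) : Prop :=
  A f (fun x => lam * f x) /\ ~ eq_L2per L f (fun=> 0).

Definition eigenvalue_of (R : realType) (L : R)
    (A : (R -> R) -> (R -> R) -> Prop) (lam : R) : Prop :=
  exists f : R -> R, eigenfunction L A lam f.

(** The eigenspace is one-dimensional. *)
Definition simple_eigenvalue (R : realType) (L : R)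
    (A : (R -> R) -> (R -> R) -> Prop) (lam : R) : Prop :=
  exists2 f : R -> R, eigenfunction L A lam f
    & forall g : R -> R, A g (fun x => lam * g x) ->
        exists a : R, eq_L2per L g (fun x => a * f x).

(* Main.v *)
Require Import Defs.
From mathcomp Require Import all_boot all_order all_algebra.
From mathcomp Require Import all_classical all_reals all_analysis.
From mathcomp Require Import measurable_realfun.
From mathcomp Require Import ring lra.

Set Implicit Arguments.
Unset Strict Implicit.
Unset Printing Implicit Defensive.
Import Order.TTheory GRing.Theory Num.Theory.
Import numFieldNormedType.Exports.
Local Open Scope classical_set_scope.
Local Open Scope ring_scope.

(** Put [w = 2K/L], [m = k^2], and let [sn], [cn], [dn] be the Jacobi functions
    of the variable [w x].  The square root of the profile is a constant plus a
    multiple of [cn^2], and after division by the positive constant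
    [kappa = 4K^2/mtilde] the eigenvalue equation with eigenvalue [lam] becomes
    the Lame equation [u'' = w^2 (30 m sn^2 - h) u] with [30 = 5 * 6] and
    [h = h0 + lam/kappa], where [h0 = 10 + 10m - 6r] and
    [r = sqrt (m^2 - m + 1)].  Thus negative eigenvalues correspond to [h < h0].
    That [mtilde > 0] is the strict monotonicity of [g], [gfun_lt].

    The potential is even about [0] and about [L/2], so a periodic solution
    splits into an odd part, with Dirichlet conditions on [[0, L/2]], and an even
    part, with Neumann conditions there.  The derivative of the profile,
    proportional to [chi = sn cn dn (r + 1 + m - 3m sn^2)], solves the equation
    for [h0] and is positive inside [[0, L/2]] with zeros at both ends.

    Sturm comparison with [chi] shows that for [h < h0] the odd part vanishes
    ([lame_dirichlet]) and that a nonzero even solution has at most one zero in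
    the open half period ([lame_one_zero]).  On the other hand the space of all
    [dn P(sn^2)] with [deg P <= 2] is invariant under the Lame operator.  If
    [h] is not one of the three eigenvalues of the resulting 3 by 3 matrix, an
    even solution is orthogonal to this space, which contains a function with
    the same sign as any function with at most one sign change; hence it
    vanishes ([lame_neumann]).  So [h] is a root of the characteristic cubic
    [lame_det], and this cubic has exactly one root below [h0], because its value
    at [h0] is [315 m^2 (m - 2 - 2r) < 0] whereas it is positive at [0] and at
    [10 + 15m > h0].  At that root the matrix gives an explicit eigenfunction,
    and uniqueness for the Cauchy problem at [0] makes the eigenvalue simple.

    Eigenfunctions are given through weak derivatives.  A weak derivative of [f]
    is turned into the statement that [f] is almost everywhere a constant plus
    the integral of it ([weak_primitive]), and two applications yield a classical
    solution of the differential equation ([H2per_ode]). *)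

(** * Calculus on the real line *)

Section Calculus.
Context {R : realType}.
Implicit Types (f g : R -> R) (x a b : R).

Lemma is_derive_cstE x a : is_derive x 1 (fun _ : R => a) 0.
Proof. exact: is_derive_cst. Qed.

Lemma is_derive_idE x : is_derive x 1 (fun y : R => y) 1.
Proof. exact: is_derive_id. Qed.

Lemma is_deriveDE f g x a b : is_derive x 1 f a -> is_derive x 1 g b ->
  is_derive x 1 (fun y => f y + g y) (a + b).
Proof. by move=> fa gb; exact: is_deriveD. Qed.

Lemma is_deriveNE f x a : is_derive x 1 f a ->
  is_derive x 1 (fun y => - f y) (- a).
Proof. by move=> fa; exact: is_deriveN. Qed.

Lemma is_deriveME f g x a b : is_derive x 1 f a -> is_derive x 1 g b ->
  is_derive x 1 (fun y => f y * g y) (a * g x + f x * b).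
Proof.
move=> fa gb; have fg := is_deriveM fa gb.
have -> : a * g x + f x * b = f x *: b + g x *: a.
  by rewrite /GRing.scale /= addrC [a * _]mulrC.
exact: fg.
Qed.

Lemma is_deriveXE f x a n : is_derive x 1 f a ->
  is_derive x 1 (fun y => f y ^+ n) (n%:R * f x ^+ n.-1 * a).
Proof.
move=> fa; have fn := is_deriveX n fa.
have <- : (n%:R * f x ^+ n.-1) *: a = n%:R * f x ^+ n.-1 * a by [].
by rewrite (_ : (fun y => f y ^+ n) = f ^+ n) // funeqE => y; rewrite exprfctE.
Qed.

Lemma is_deriveVE f x a : f x != 0 -> is_derive x 1 f a ->
  is_derive x 1 (fun y => (f y)^-1) (- a / f x ^+ 2).
Proof.
move=> fx fa; have fV := is_deriveV fx fa.
have -> : - a / f x ^+ 2 = - (f x) ^- 2 *: a by rewrite /GRing.scale /= !mulNr mulrC.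
exact: fV.
Qed.

Lemma is_derive_compE f g x a b : is_derive (g x) 1 f a -> is_derive x 1 g b ->
  is_derive x 1 (fun y => f (g y)) (a * b).
Proof. by move=> fa gb; exact: is_derive1_comp. Qed.

Lemma is_derive_continuous f x a : is_derive x 1 f a -> {for x, continuous f}.
Proof.
by move=> [df _]; apply/differentiable_continuous; exact/derivable1_diffP.
Qed.

Lemma is_derive_sinE f x a : is_derive x 1 f a ->
  is_derive x 1 (fun y => sin (f y)) (cos (f x) * a).
Proof. by move=> fa; apply: is_derive_compE. Qed.

Lemma is_derive_cosE f x a : is_derive x 1 f a ->
  is_derive x 1 (fun y => cos (f y)) (- sin (f x) * a).
Proof. by move=> fa; apply: is_derive_compE. Qed.

Lemma is_derive_expRE f x a : is_derive x 1 f a ->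
  is_derive x 1 (fun y => expR (f y)) (expR (f x) * a).
Proof. by move=> fa; apply: is_derive_compE. Qed.

Lemma is_derive_sqrtE f x a : 0 < f x -> is_derive x 1 f a ->
  is_derive x 1 (fun y => Num.sqrt (f y)) ((2 * Num.sqrt (f x))^-1 * a).
Proof. by move=> fx fa; apply: is_derive_compE; exact: is_derive1_sqrt. Qed.

End Calculus.

(** Reads a derivative off the shape of the function; [der] leaves the equality
    between the derivative so computed and the expected one. *)
Ltac der_step :=
  match goal with
  | |- is_derive _ _ (fun y => y) _ => apply: is_derive_idE
  | |- is_derive _ _ (fun y => ?c) _ => apply: is_derive_cstE
  | |- is_derive _ _ ( *%R ?c) _ =>
      eapply (@is_deriveME _ (fun _ => c) (fun y => y))
  | |- is_derive _ _ ( +%R ?c) _ =>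
      eapply (@is_deriveDE _ (fun _ => c) (fun y => y))
  | |- is_derive _ _ -%R _ => eapply (@is_deriveNE _ (fun y => y))
  | |- is_derive _ _ sin _ => eapply is_derive_sin
  | |- is_derive _ _ cos _ => eapply is_derive_cos
  | |- is_derive _ _ (fun y => _ + _) _ => eapply is_deriveDE
  | |- is_derive _ _ (fun y => - _) _ => eapply is_deriveNE
  | |- is_derive _ _ (fun y => _ * _) _ => eapply is_deriveME
  | |- is_derive _ _ (fun y => _ ^+ _) _ => eapply is_deriveXE
  | |- is_derive _ _ (fun y => sin _) _ => eapply is_derive_sinE
  | |- is_derive _ _ (fun y => cos _) _ => eapply is_derive_cosE
  | |- is_derive _ _ (fun y => expR _) _ => eapply is_derive_expRE
  end.
Ltac der := eapply is_derive_eq; [repeat (first [eassumption | der_step])|rewrite /=].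

Section Monotone.
Context {R : realType}.
Implicit Types (f : R -> R) (x a b : R).

Lemma is_derive_MVT f (df : R -> R) a b : a < b ->
  (forall x, a <= x <= b -> is_derive x 1 f (df x)) ->
  exists2 c, a < c < b & f b - f a = df c * (b - a).
Proof.
move=> ab fd.
have [||c cab e] := @MVT R f df a b ab.
- by move=> x; rewrite in_itv /= => /andP[ax xb]; apply: fd; rewrite !ltW.
- apply/continuous_in_subspaceT => x; rewrite inE /= in_itv /= => axb.
  by apply: is_derive_continuous (fd _ axb).
by exists c => //; move: cab; rewrite in_itv.
Qed.

Lemma is_derive_nondecreasing f (df : R -> R) a b : a <= b ->
  (forall x, a <= x <= b -> is_derive x 1 f (df x)) ->
  (forall x, a < x < b -> 0 <= df x) -> f a <= f b.
Proof.
rewrite le_eqVlt => /predU1P[->//|ab] fd d0.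
have [c /d0 dc e] := is_derive_MVT ab fd.
by rewrite -subr_ge0 e mulr_ge0 // subr_ge0 ltW.
Qed.

Lemma is_derive_increasing f (df : R -> R) a b : a < b ->
  (forall x, a <= x <= b -> is_derive x 1 f (df x)) ->
  (forall x, a < x < b -> 0 < df x) -> f a < f b.
Proof.
move=> ab fd d0.
have [c /d0 dc e] := is_derive_MVT ab fd.
by rewrite -subr_gt0 e mulr_gt0 // subr_gt0.
Qed.

Lemma IVT0 f a b : a <= b ->
  (forall x, a <= x <= b -> {for x, continuous f}) -> f a * f b < 0 ->
  exists2 c, a < c < b & f c = 0.
Proof.
move=> ab fc fab.
have [||c] := @IVT R f a b 0 ab.
- apply/continuous_in_subspaceT => x; rewrite inE /= in_itv /=; exact: fc.
- by case: (ltgtP (f a) 0) fab => [fa|fa|->]; rewrite ?mul0r ?ltxx //;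
   rewrite ?(nmulr_rlt0 _ fa) ?(pmulr_rlt0 _ fa) => fb;
   rewrite ge_min le_max ?(ltW fa) ?(ltW fb) ?orbT.
rewrite in_itv /= => /andP[ac cb] fc0; exists c => //.
move: fab; rewrite !lt_neqAle ac cb !andbT.
case: (eqVneq a c) => [->|_]; first by rewrite fc0 mul0r eqxx.
by case: (eqVneq c b) => [<-|//]; rewrite fc0 mulr0 eqxx.
Qed.

End Monotone.

Section Primitive.
Context {R : realType}.
Notation mu := (@lebesgue_measure R).
Implicit Types (f : R -> R).

Lemma continuous_integrable_itv f a b : continuous f ->
  mu.-integrable `[a, b] (EFin \o f).
Proof.
move=> fc; apply: continuous_compact_integrable; first exact: segment_compact.
exact: continuous_subspaceT.
Qed.

(** The integral is oriented for [x < 0], so that for a continuous [f] this is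
    the primitive on the whole line that vanishes at [0]. *)
Definition oint f (x : R) : R :=
  if 0 <= x then \int[mu]_(t in `[0, x]) f t
  else - \int[mu]_(t in `[x, 0]) f t.

Lemma oint0 f : oint f 0 = 0.
Proof. by rewrite /oint lexx set_itv1 Rintegral_set1. Qed.

(** Near [x] this differs by a constant from the integral over [[a, x]] with a
    fixed [a] below both [x] and [0], where the fundamental theorem applies. *)
Lemma is_derive_oint f (x : R) : continuous f -> is_derive x 1 (oint f) (f x).
Proof.
move=> fc; pose a : R := - (`|x| + 1).
have xa : a < x by rewrite /a; have := ler_norm (- x); rewrite normrN; lra.
have a0 : a < 0 by rewrite /a; have := normr_ge0 x; lra.
pose I y := \int[mu]_(t in `[a, y]) f t.
have fi y z : mu.-integrable `[y, z] (EFin \o f) by exact: continuous_integrable_itv.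
have split_int y z : a <= y -> y <= z ->
    I z - I y = \int[mu]_(t in `[y, z]) f t.
  move=> ay yz; rewrite /I Rintegral_itvB //.
  rewrite Rintegral_itv_obnd_cbnd //.
  by apply: integrableS (fi y z) => //; exact: subset_itv_oc_cc.
have Ed : is_derive x 1 (fun y => I y - I 0) (f x).
  have [dI eI] := @continuous_FTC1_closed R f a x (x + 1)
    (ltr_pwDr ltr01 (lexx x)) (fi _ _) xa (fc x).
  have Id : is_derive x 1 I (f x) by rewrite -eI derive1E; exact: derivableP.
  have := is_deriveDE Id (is_deriveNE (is_derive_cstE x (I 0))).
  by rewrite oppr0 addr0.
apply: near_eq_is_derive Ed => //.
near=> y.
have ay : a <= y by apply: ltW; near: y; apply: lt_nbhsr.
rewrite /oint; case: ifP => y0.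
  by rewrite -split_int // ltW.
rewrite -split_int //; first by rewrite opprB.
by rewrite ltW // ltNge y0.
Unshelve. all: by end_near. Qed.

End Primitive.

(** * Sturm comparison and the characteristic cubic *)

Section Sturm.
Context {R : realType}.
Implicit Types (p u v chi : R -> R) (x a b M : R).

(** The derivatives are two-sided even at the end points of [[a, b]], so no
    one-sided limits occur in the comparison arguments. *)
Definition solves p u u1 a b := forall x, a <= x <= b ->
  is_derive x 1 u (u1 x) /\ is_derive x 1 u1 (p x * u x).

Lemma solvesW p u u1 a b a' b' : a <= a' -> b' <= b ->
  solves p u u1 a b -> solves p u u1 a' b'.
Proof.
move=> aa bb S x /andP[ax xb]; apply: S.
by rewrite (le_trans aa ax) (le_trans xb bb).
Qed.

Lemma is_derive_locally0 (f : R -> R) a b x d : a < x < b ->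
  (forall y, a < y < b -> f y = 0) -> is_derive x (1 : R) f d -> d = 0.
Proof.
move=> /andP[ax xb] f0 fd.
have H : is_derive x (1 : R) (fun=> 0 : R) d.
  apply: near_eq_is_derive fd => //.
  near=> y; rewrite f0 //; apply/andP; split.
    by near: y; apply: lt_nbhsr.
  by near: y; apply: lt_nbhsl.
have [_ <-] := H.
by have [_ ->] := is_derive_cstE x (0 : R).
Unshelve. all: by end_near. Qed.

(** Gronwall: the derivative of [u^2 + u1^2] is at most [1 + M] times
    [u^2 + u1^2] in absolute value, so multiplying by [expR (C x)] with
    [C = 1 + M] or [C = - (1 + M)] gives a monotone function that vanishes at
    [z]. *)
Lemma solves_unique p u u1 a b M z : a <= z <= b ->
  (forall x, a <= x <= b -> `|p x| <= M) ->
  solves p u u1 a b -> u z = 0 -> u1 z = 0 ->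
  forall x, a <= x <= b -> u x = 0.
Proof.
move=> /andP[az zb] pM S uz u1z x /andP[ax xb].
pose E (C : R) y := (u y ^+ 2 + u1 y ^+ 2) * expR (C * y).
have Ed C y : a <= y <= b -> is_derive y 1 (E C)
    ((2 * u y * u1 y * (1 + p y) + C * (u y ^+ 2 + u1 y ^+ 2)) * expR (C * y)).
  by move=> /S[h1 h2]; rewrite /E; der; ring.
have bnd y : a <= y <= b ->
    `|2 * u y * u1 y * (1 + p y)| <= (1 + M) * (u y ^+ 2 + u1 y ^+ 2).
  move=> /pM py; have := sqr_ge0 (u y + u1 y); have := sqr_ge0 (u y - u1 y).
  rewrite normrM mulrC => h1 h2; apply: ler_pM => //.
    by rewrite (le_trans (ler_normD _ _)) // normr1 lerD2l.
  by rewrite ler_norml; apply/andP; split; nra.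
have E0 : E (1 + M) z = 0 /\ E (- (1 + M)) z = 0.
  by rewrite /E uz u1z expr0n /= addr0 !mul0r.
suff: u x ^+ 2 + u1 x ^+ 2 <= 0.
  move=> h; apply/eqP; rewrite -sqrf_eq0 eq_le sqr_ge0 andbT.
  by rewrite (le_trans _ h) // lerDl sqr_ge0.
have [xz|zx] := leP x z.
- have : E (1 + M) x <= E (1 + M) z.
    apply: (is_derive_nondecreasing (f := E (1 + M)) xz) => y /andP[xy yz].
      by apply: Ed; rewrite (le_trans ax xy) (le_trans yz zb).
    have /bnd : a <= y <= b.
      by rewrite (le_trans ax (ltW xy)) (le_trans (ltW yz) zb).
    rewrite ler_norml => /andP[h _].
    by rewrite /= mulr_ge0 ?expR_ge0 // -lerBlDr sub0r.
  by rewrite E0.1 /E pmulr_lle0 // expR_gt0.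
- have : E (- (1 + M)) x <= E (- (1 + M)) z.
    rewrite -lerN2.
    apply: (is_derive_nondecreasing (f := fun y => - E (- (1 + M)) y) (ltW zx)) => y /andP[zy yx].
      by apply: is_deriveNE; apply: Ed; rewrite (le_trans az zy) (le_trans yx xb).
    have /bnd : a <= y <= b.
      by rewrite (le_trans az (ltW zy)) (le_trans (ltW yx) xb).
    rewrite ler_norml => /andP[_ h].
    by rewrite /= -mulNr mulr_ge0 ?expR_ge0 // opprD mulNr opprK addrC subr_ge0.
  by rewrite E0.2 /E pmulr_lle0 // expR_gt0.
Qed.

Definition wronskian u u1 v v1 x := u1 x * v x - u x * v1 x.

Lemma is_derive_wronskian u u1 v v1 x (u2 v2 : R) :
  is_derive x 1 u (u1 x) -> is_derive x 1 u1 u2 ->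
  is_derive x 1 v (v1 x) -> is_derive x 1 v1 v2 ->
  is_derive x 1 (wronskian u u1 v v1) (u2 * v x - u x * v2).
Proof. by move=> h1 h2 h3 h4; rewrite /wronskian; der; ring. Qed.

Section Comparison.
Variables (p u u1 chi chi1 : R -> R) (a b de : R).
Hypotheses (de0 : 0 < de) (Su : solves p u u1 a b)
  (Sc : solves (fun x => p x - de) chi chi1 a b)
  (chi0 : forall x, a < x < b -> 0 < chi x).

Let W := wronskian u u1 chi chi1.
Let E x := W x * u x / chi x.

Let dW x : a <= x <= b -> is_derive x 1 W (de * u x * chi x).
Proof.
move=> xab; have [h1 h2] := Su xab; have [h3 h4] := Sc xab.
by eapply is_derive_eq; [exact: (is_derive_wronskian h1 h2 h3 h4)|ring].
Qed.

Let dE x : a < x < b ->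
  is_derive x 1 E (de * u x ^+ 2 + (W x / chi x) ^+ 2).
Proof.
move=> xab; have c0 : chi x != 0 by rewrite gt_eqF ?chi0.
have xab' : a <= x <= b by case/andP: xab => *; rewrite !ltW.
have [h1 h2] := Su xab'; have [h3 h4] := Sc xab'; have h5 := dW xab'.
have h6 := is_deriveVE c0 h3.
rewrite /E; der; rewrite /W /wronskian; field; exact: c0.
Qed.

Let dE0 x : 0 <= de * u x ^+ 2 + (W x / chi x) ^+ 2.
Proof. by rewrite addr_ge0 ?sqr_ge0 // mulr_ge0 ?sqr_ge0 ?ltW. Qed.

Let E_le x y : a < x -> y < b -> x <= y -> E x <= E y.
Proof.
move=> ax yb xy; apply: (is_derive_nondecreasing (f := E) xy) => z.
  by move=> /andP[xz zy]; apply: dE; rewrite (lt_le_trans ax xz) (le_lt_trans zy yb).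
by move=> _; exact: dE0.
Qed.

Let dW2 x : a <= x <= b -> is_derive x 1 (fun y => W y ^+ 2) (2 * de * (u x * W x * chi x)).
Proof. by move=> /dW h; der; ring. Qed.

Let EW x : a < x < b -> u x * W x * chi x = E x * chi x ^+ 2.
Proof.
move=> /chi0 c0; rewrite /E; field; exact: lt0r_neq0.
Qed.

Let de2 (e c : R) : 0 <= e -> 0 <= 2 * de * (e * c ^+ 2).
Proof.
by move=> e0; rewrite mulr_ge0 // mulr_ge0 ?sqr_ge0 // ltW.
Qed.

Let E_eq0 a' b' x : a <= a' -> b' <= b -> a' < x < b' ->
  (forall y, a' < y < b' -> E y = 0) -> u x = 0.
Proof.
move=> aa bb xab E0.
have xab' : a < x < b.
  by case/andP: xab => ax xb; rewrite (le_lt_trans aa ax) (lt_le_trans xb bb).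
have /eqP := is_derive_locally0 xab E0 (dE xab').
have du : 0 <= de * u x ^+ 2 by rewrite mulr_ge0 ?sqr_ge0 // ltW.
rewrite (paddr_eq0 du (sqr_ge0 _)) => /andP[+ _].
by rewrite mulf_eq0 gt_eqF //= sqrf_eq0 => /eqP.
Qed.

(** The function [E = W u / chi] is nondecreasing, and [(W^2)' = 2 de chi^2 E].
    If [E] is positive at some point then [W^2] does not decrease to the right of
    it and [W b] cannot be [0]; if [E] is negative then likewise [W a] cannot be
    [0].  Hence [E] is [0], and [E' = 0] gives [u = 0].  At the end
    points, where [chi] may vanish, only [W] enters. *)
Lemma comparison_dirichlet : W a = 0 -> W b = 0 ->
  forall x, a < x < b -> u x = 0.
Proof.
move=> Wa Wb x xab; apply: (E_eq0 (lexx a) (lexx b) xab) => {x xab} y.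
move=> /[dup] yab /andP[ay yb].
have W0 : E y != 0 -> 0 < W y ^+ 2.
  by move=> h; rewrite lt0r sqr_ge0 sqrf_eq0 andbT; apply: contraNneq h => W0;
     rewrite /E W0 !mul0r.
case: (ltgtP (E y) 0) => // Ey.
- have : W y ^+ 2 <= W a ^+ 2.
    rewrite -lerN2.
    apply: (is_derive_nondecreasing (f := fun z => - W z ^+ 2) (ltW ay)) => z /andP[az zy].
      by apply: is_deriveNE; apply: dW2; rewrite az (le_trans zy (ltW yb)).
    rewrite /= EW ?az ?(lt_trans zy yb) // -mulrN -mulNr; apply: de2.
    rewrite oppr_ge0; exact: le_trans (E_le az yb (ltW zy)) (ltW Ey).
  by rewrite Wa expr0n leNgt W0 ?lt_eqF.
- have : W y ^+ 2 <= W b ^+ 2.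
    apply: (is_derive_nondecreasing (f := fun z => W z ^+ 2) (ltW yb)) => z /andP[yz zb].
      by apply: dW2; rewrite zb (le_trans (ltW ay) yz).
    rewrite /= EW ?zb ?(lt_trans ay yz) //; apply: de2.
    exact: le_trans (ltW Ey) (E_le ay zb (ltW yz)).
  by rewrite Wb expr0n leNgt W0 ?gt_eqF.
Qed.

(** The nondecreasing function [E] vanishes with [u] at [y] and [z], hence
    between them, and again [E' = 0] gives [u = 0]. *)
Lemma comparison_two_zeros y z : a < y -> y < z -> z < b -> u y = 0 -> u z = 0 ->
  forall x, y < x < z -> u x = 0.
Proof.
move=> ay yz zb uy uz x xyz.
apply: (E_eq0 (ltW ay) (ltW zb) xyz) => t /andP[yt tz].
apply/eqP; rewrite eq_le; apply/andP; split.
  have -> : 0 = E z by rewrite /E uz mulr0 mul0r.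
  by apply: E_le => //; [exact: lt_trans yt|exact: ltW].
have -> : 0 = E y by rewrite /E uy mulr0 mul0r.
by apply: E_le => //; [exact: lt_trans zb|exact: ltW].
Qed.

End Comparison.
End Sturm.

Section Cubic.
Context {R : realFieldType}.
Variables (m r : R).
Hypotheses (m01 : 0 < m < 1) (r0 : 0 < r) (rE : r ^+ 2 = m ^+ 2 - m + 1).

(** Determinant of [T - h], where [T] is the matrix of the Lame operator on the
    span of [dn], [dn sn^2] and [dn sn^4]. *)
Definition lame_det (h : R) : R :=
  (m - h) * ((4 + 9 * m - h) * (16 + 25 * m - h) + 216 * m)
  + 56 * m * (16 + 25 * m - h).

(** The spectral parameter of the derivative of the wave profile. *)
Definition lame_edge : R := 10 + 10 * m - 6 * r.

Lemma lame_det_edge : lame_det lame_edge = 315 * m ^+ 2 * (m - 2 - 2 * r).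
Proof.
have -> : lame_det lame_edge = m * (
  21 * (6 * r - 10 - 9 * m) * (m + 4 + 4 * r) + 56 * (6 + 15 * m + 6 * r))
  + 36 * (6 * r - 10 - 9 * m) * (r ^+ 2 - (m ^+ 2 - m + 1)).
  by rewrite /lame_det /lame_edge; ring.
rewrite rE subrr mulr0 addr0.
have -> : 21 * (6 * r - 10 - 9 * m) * (m + 4 + 4 * r) =
  21 * (24 * r ^+ 2 - 30 * m * r - 16 * r - 9 * m ^+ 2 - 46 * m - 40) by ring.
by rewrite rE; ring.
Qed.

Lemma lame_det_edge_lt0 : lame_det lame_edge < 0.
Proof.
rewrite lame_det_edge; case/andP: m01 => m0 m1.
have m2 : 0 < 315 * m ^+ 2 by rewrite mulr_gt0 // exprn_gt0.
by rewrite (pmulr_rlt0 _ m2); move: r0; lra.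
Qed.

Lemma lame_det0_gt0 : 0 < lame_det 0.
Proof. by case/andP: m01 => m0 m1; rewrite /lame_det; nra. Qed.

Lemma lame_det_above_gt0 : 0 < lame_det (10 + 15 * m).
Proof.
case/andP: m01 => m0 m1.
(* The cubic in [m] has its minimum on (0, 1) near 5/8; completing the square
   there leaves a positive quadratic. *)
have -> : lame_det (10 + 15 * m) = 840 * (m * (m - 5 / 8) ^+ 2) +
    (530 * m ^+ 2 - 5505 / 8 * m + 360) by rewrite /lame_det; field.
have := mulr_ge0 (ltW m0) (sqr_ge0 (m - 5 / 8)).
by have := sqr_ge0 (m - 65 / 100); nra.
Qed.

Lemma lame_edge_gt0 : 0 < lame_edge.
Proof.
case/andP: m01 => m0 m1; rewrite /lame_edge.
suff : r < 1 + m by lra.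
by rewrite -(ltr_pXn2r (n := 2)) ?nnegrE ?ltW ?rE //; nra.
Qed.

(** If [h] and [h'] were distinct then the cubic would factor over [h], [h'] and a
    third root [e].  Its negative value at the edge forces [e] below the edge, and
    then it would be negative at every larger point, in particular at
    [10 + 15 m]. *)
Lemma lame_det_root_unique h h' : h < lame_edge -> h' < lame_edge ->
  lame_det h = 0 -> lame_det h' = 0 -> h = h'.
Proof.
move=> hl hl' Dh Dh'; apply/eqP; apply: contraT => hh.
(* The sum of the three roots is the trace of [T]. *)
pose e := 20 + 35 * m - h - h'.
have fac x : lame_det x = - ((x - h) * (x - h') * (x - e)).
  have nz : h' - h != 0 by rewrite subr_eq0 eq_sym.
  apply: (mulIf nz); apply/eqP; rewrite -subr_eq0; apply/eqP.
  transitivity (lame_det h * (h' - x) + lame_det h' * (x - h)).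
    by rewrite /lame_det /e; ring.
  by rewrite Dh Dh' !mul0r addr0.
have := lame_det_edge_lt0; rewrite fac oppr_lt0 => h1.
have {h1} el : e < lame_edge.
  by rewrite -subr_gt0; move: h1; rewrite pmulr_rgt0 // mulr_gt0 // subr_gt0.
have up : lame_edge < 10 + 15 * m.
  by move: r0; case/andP: m01 => m0 m1; rewrite /lame_edge; lra.
have := lame_det_above_gt0; rewrite fac oppr_gt0 ltNge => /negP[].
rewrite ltW // !mulr_gt0 // subr_gt0; first exact: lt_trans hl up.
  exact: lt_trans hl' up.
exact: lt_trans el up.
Qed.

End Cubic.

(** * Solutions of the Lame equation built from the Jacobi functions *)

Section Lame.
Context {R : realType}.
Implicit Types x : R.

(** The Jacobi functions of the variable [w x] with parameter [m]: the frequency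
    [w] is kept inside, so that the Lame equation is written in the variable of
    the wave profile. *)
Record jacobi_triple (w m : R) (sn cn dn : R -> R) : Prop := JacobiTriple {
  sn_deriv : forall x, is_derive x 1 sn (w * (cn x * dn x));
  cn_deriv : forall x, is_derive x 1 cn (- (w * (sn x * dn x)));
  dn_deriv : forall x, is_derive x 1 dn (- (w * m * (sn x * cn x)));
  cn_sqr : forall x, cn x ^+ 2 = 1 - sn x ^+ 2;
  dn_sqr : forall x, dn x ^+ 2 = 1 - m * sn x ^+ 2;
  dn_gt0 : forall x, 0 < dn x }.

Variables (w m r : R) (sn cn dn : R -> R).
Hypothesis J : jacobi_triple w m sn cn dn.

Definition lame_pot (h x : R) : R := w ^+ 2 * (30 * m * sn x ^+ 2 - h).

Definition lame_fun (a b c x : R) : R :=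
  dn x * (a + b * sn x ^+ 2 + c * sn x ^+ 4).

Definition lame_fun1 (a b c x : R) : R :=
  w * (sn x * cn x) * (- m * (a + b * sn x ^+ 2 + c * sn x ^+ 4)
    + 2 * dn x ^+ 2 * (b + 2 * c * sn x ^+ 2)).

Lemma is_derive_lame_fun a b c x :
  is_derive x 1 (lame_fun a b c) (lame_fun1 a b c x).
Proof.
have h1 := sn_deriv J x; have h2 := cn_deriv J x; have h3 := dn_deriv J x.
by rewrite /lame_fun /lame_fun1; der; ring.
Qed.

(** The coefficients in the last term are those of the image of [(a, b, c)] under
    the matrix [T].  The family is invariant because the terms of degree 6 in
    [sn] cancel for the coefficient [30]. *)
Lemma is_derive_lame_fun1 a b c x :
  is_derive x 1 (lame_fun1 a b c) (w ^+ 2 * (30 * m * sn x ^+ 2 * lame_fun a b c x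
    - lame_fun (m * a - 2 * b) (28 * m * a + (4 + 9 * m) * b - 12 * c)
        (18 * m * b + (16 + 25 * m) * c) x)).
Proof.
have h1 := sn_deriv J x; have h2 := cn_deriv J x; have h3 := dn_deriv J x.
rewrite /lame_fun1 /lame_fun; der.
transitivity (w ^+ 2 * dn x * (
  (cn x ^+ 2 - sn x ^+ 2) * (- m * (a + b * sn x ^+ 2 + c * sn x ^+ 4)
    + 2 * dn x ^+ 2 * (b + 2 * c * sn x ^+ 2))
  + sn x ^+ 2 * cn x ^+ 2 * (- 6 * m * (b + 2 * c * sn x ^+ 2)
    + 8 * c * dn x ^+ 2))); first by ring.
by rewrite (cn_sqr J) (dn_sqr J); ring.
Qed.

(** Proportional to the derivative of the wave profile. *)
Definition lame_kernel (x : R) : R :=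
  sn x * cn x * dn x * (r + 1 + m - 3 * m * sn x ^+ 2).

Definition lame_kernel1 (x : R) : R :=
  w * ((cn x ^+ 2 * dn x ^+ 2 - sn x ^+ 2 * dn x ^+ 2 - m * sn x ^+ 2 * cn x ^+ 2)
    * (r + 1 + m - 3 * m * sn x ^+ 2) - 6 * m * sn x ^+ 2 * cn x ^+ 2 * dn x ^+ 2).

Lemma is_derive_lame_kernel x : is_derive x 1 lame_kernel (lame_kernel1 x).
Proof.
have h1 := sn_deriv J x; have h2 := cn_deriv J x; have h3 := dn_deriv J x.
by rewrite /lame_kernel /lame_kernel1; der; ring.
Qed.

Hypothesis rE : r ^+ 2 = m ^+ 2 - m + 1.

Lemma is_derive_lame_kernel1 x :
  is_derive x 1 lame_kernel1 (lame_pot (lame_edge m r) x * lame_kernel x).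
Proof.
have h1 := sn_deriv J x; have h2 := cn_deriv J x; have h3 := dn_deriv J x.
rewrite /lame_pot /lame_edge /lame_kernel.
have -> : lame_kernel1 = (fun y : R => w * ((1 + (- (2 * (1 + m))) * sn y ^+ 2
    + 3 * m * sn y ^+ 4) * (r + 1 + m + (- (3 * m)) * sn y ^+ 2)
    + (- (6 * m)) * (sn y ^+ 2 + (- (1 + m)) * sn y ^+ 4 + m * sn y ^+ 6))).
  by apply/funext => y; rewrite /lame_kernel1 (cn_sqr J) (dn_sqr J); ring.
der.
apply/eqP; rewrite -subr_eq0; apply/eqP.
transitivity (6 * w ^+ 2 * sn x * cn x * dn x * (m ^+ 2 - m + 1 - r ^+ 2)).
  by ring.
by rewrite rE; ring.
Qed.

(** The coefficients annihilate the first two rows of [T - h]; the third row then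
    gives [lame_det m h].  The factor 24 clears denominators. *)
Definition lame_ground (h : R) : R -> R :=
  lame_fun (24 : R) (12 * (m - h))
    (56 * m + (4 + 9 * m - h) * (m - h)).
Definition lame_ground1 (h : R) : R -> R :=
  lame_fun1 (24 : R) (12 * (m - h))
    (56 * m + (4 + 9 * m - h) * (m - h)).

Lemma is_derive_lame_ground1 h x : lame_det m h = 0 ->
  is_derive x 1 (lame_ground1 h) (lame_pot h x * lame_ground h x).
Proof.
move=> D0; have := is_derive_lame_fun1 24 (12 * (m - h))
    (56 * m + (4 + 9 * m - h) * (m - h)) x.
rewrite -/(lame_ground1 h); congr (is_derive _ _ _ _).
rewrite /lame_pot /lame_ground /lame_fun.
apply/eqP; rewrite -subr_eq0; apply/eqP.
transitivity (- w ^+ 2 * dn x * sn x ^+ 4 * lame_det m h); last by rewrite D0 mulr0.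
by rewrite /lame_det; ring.
Qed.

End Lame.

(** * Periodic solutions of the Lame equation *)

Section LamePeriodic.
Context {R : realType}.
Implicit Types x : R.

Lemma constant_sign (f : R -> R) (a b : R) :
  (forall x, a < x < b -> {for x, continuous f}) ->
  (forall x, a < x < b -> f x != 0) ->
  forall x y, a < x < b -> a < y < b -> 0 < f x * f y.
Proof.
move=> fc f0 x y; wlog xy : x y / x <= y => [H xab yab|].
  by have [/H->//|/ltW/H] := leP x y; rewrite mulrC; apply.
move=> /andP[ax xb] /andP[ay yb]; rewrite ltNge; apply/negP.
rewrite le_eqVlt mulf_eq0 !(negbTE (f0 _ _)) ?ax ?ay //= => fxy.
have [|z /andP[xz zy] /eqP] := IVT0 xy _ fxy.
  by move=> z /andP[xz zy]; apply: fc; rewrite (lt_le_trans ax) ?(le_lt_trans zy).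
by apply/negP/f0; rewrite (lt_trans ax xz) (lt_trans zy yb).
Qed.

Variables (w m r ell : R) (sn cn dn : R -> R).
Hypotheses (J : jacobi_triple w m sn cn dn) (w0 : 0 < w) (m01 : 0 < m < 1)
  (r0 : 0 < r) (rE : r ^+ 2 = m ^+ 2 - m + 1) (ell0 : 0 < ell).
Hypotheses (sn0 : sn 0 = 0) (cnell : cn ell = 0)
  (snp : forall x, 0 < x < ell -> 0 < sn x)
  (cnp : forall x, 0 < x < ell -> 0 < cn x)
  (snr : forall x, sn (2 * ell - x) = sn x)
  (dnr : forall x, dn (2 * ell - x) = dn x).
Variable h : R.
Hypothesis hlt : h < lame_edge m r.

Let p := lame_pot w m sn h.
Let D := lame_det m h.

Let sn_le1 x : sn x ^+ 2 <= 1.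
Proof. by have := sqr_ge0 (cn x); rewrite (cn_sqr J) subr_ge0. Qed.

(** The last factor is at least [r + 1 - 2 m], and
    [r^2 - (2 m - 1)^2 = 3 m (1 - m)]. *)
Lemma lame_kernel_gt0 x : 0 < x < ell -> 0 < lame_kernel m r sn cn dn x.
Proof.
move=> xl; rewrite /lame_kernel mulr_gt0 //.
  by rewrite !mulr_gt0 ?snp ?cnp ?(dn_gt0 J).
have r2 : 2 * m - 1 < r by move: m01 r0 rE => /andP[m0 m1] h1 h2; nra.
have : m * sn x ^+ 2 <= m by case/andP: m01 => m0 _; rewrite ger_pMr.
by move: r2; lra.
Qed.

Let solves_kernel : solves (fun x => p x - w ^+ 2 * (lame_edge m r - h))
  (lame_kernel m r sn cn dn) (lame_kernel1 w m r sn cn dn) 0 ell.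
Proof.
move=> x _; split; first exact: is_derive_lame_kernel.
eapply is_derive_eq; first exact: (is_derive_lame_kernel1 J rE x).
by rewrite /p /lame_pot; ring.
Qed.

Let gap_gt0 : 0 < w ^+ 2 * (lame_edge m r - h).
Proof. by rewrite mulr_gt0 ?exprn_gt0 // subr_gt0. Qed.

Let pM x : `|p x| <= w ^+ 2 * (30 * m + `|h|).
Proof.
rewrite /p /lame_pot normrM (ger0_norm (sqr_ge0 w)) ler_wpM2l ?sqr_ge0 //.
rewrite (le_trans (ler_normB _ _)) // lerD2r ger0_norm.
  by rewrite ger_pMr ?sn_le1 // mulr_gt0 //; case/andP: m01.
by rewrite mulr_ge0 ?sqr_ge0 // mulr_ge0 // ltW //; case/andP: m01.
Qed.

Lemma lame_dirichlet u u1 : solves p u u1 0 ell -> u 0 = 0 -> u ell = 0 ->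
  forall x, 0 <= x <= ell -> u x = 0.
Proof.
move=> S u0 ul x /andP[]; rewrite !le_eqVlt => /predU1P[<-//|x0] /predU1P[->//|xl].
apply: (comparison_dirichlet gap_gt0 S solves_kernel lame_kernel_gt0); last first.
- by rewrite x0.
- by rewrite /wronskian ul /lame_kernel cnell !(mul0r, mulr0) subr0.
- by rewrite /wronskian u0 /lame_kernel sn0 !(mul0r, mulr0) subr0.
Qed.

Section Neumann.
Variables (u u1 : R -> R).
Hypotheses (S : solves p u u1 0 ell) (u10 : u1 0 = 0) (u1l : u1 ell = 0).

(** Two zeros would force [u] to vanish between them, by comparison with the
    kernel function, and then everywhere by uniqueness for the Cauchy problem. *)
Lemma lame_one_zero y z : 0 < y -> y < z -> z < ell -> u y = 0 -> u z = 0 ->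
  forall x, 0 <= x <= ell -> u x = 0.
Proof.
move=> y0 yz zl uy uz.
have H := comparison_two_zeros gap_gt0 S solves_kernel lame_kernel_gt0 y0 yz zl uy uz.
pose t := (y + z) / 2.
have tyz : y < t < z by rewrite /t; lra.
have t0l : 0 <= t <= ell by rewrite /t; lra.
apply: (solves_unique t0l (fun x _ => pM x) S (H _ tyz)).
have [ut _] := S t0l.
exact: is_derive_locally0 tyz H ut.
Qed.

(** The sign hypothesis contradicts, unless the product is identically [0], the
    orthogonality of [u] to [dn (q0 + q1 sn^2)].  The integral is avoided: the
    product is, up to the factor [w^2 D^2 dn], the derivative of a Wronskian that
    vanishes at both ends. *)
Lemma lame_orthogonal (q0 q1 : R) : D != 0 ->
  (forall x, 0 < x < ell -> 0 <= u x * (q0 + q1 * sn x ^+ 2)) ->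
  forall x, 0 < x < ell -> u x * (q0 + q1 * sn x ^+ 2) = 0.
Proof.
move=> D0 uq.
pose a := m - h; pose b := 4 + 9 * m - h; pose c := 16 + 25 * m - h.
(* The adjugate of [T - h] applied to [(q0, q1, 0)]; the extra factor [D] makes
   the coefficient [D ^+ 2] below positive. *)
pose a0 := D * (q0 * (b * c + 216 * m) + 2 * c * q1).
pose a1 := D * (- 28 * m * c * q0 + a * c * q1).
pose a2 := D * (504 * m ^+ 2 * q0 - 18 * m * a * q1).
pose v := lame_fun sn dn a0 a1 a2; pose v1 := lame_fun1 w m sn cn dn a0 a1 a2.
pose W := wronskian u u1 v v1.
have dW x : 0 <= x <= ell -> is_derive x 1 W
    (w ^+ 2 * D ^+ 2 * (dn x * (u x * (q0 + q1 * sn x ^+ 2)))).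
  move=> /S[h1 h2].
  have h3 := is_derive_lame_fun J a0 a1 a2 x.
  have h4 := is_derive_lame_fun1 J a0 a1 a2 x.
  eapply is_derive_eq; first exact: (is_derive_wronskian h1 h2 h3 h4).
  rewrite /v /lame_fun /p /lame_pot /a0 /a1 /a2 /D /lame_det /a /b /c; ring.
have dWp x : 0 < x < ell ->
    0 <= w ^+ 2 * D ^+ 2 * (dn x * (u x * (q0 + q1 * sn x ^+ 2))).
  move=> xl; apply: mulr_ge0; first by rewrite mulr_ge0 ?sqr_ge0.
  by apply: mulr_ge0; [exact/ltW/(dn_gt0 J)|exact: uq].
have W0 : W 0 = 0.
  by rewrite /W /wronskian u10 /v1 /lame_fun1 sn0 !(mul0r, mulr0) subr0.
have Wl : W ell = 0.
  by rewrite /W /wronskian u1l /v1 /lame_fun1 cnell !(mul0r, mulr0) subr0.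
have mono x y : 0 <= x -> y <= ell -> x <= y -> W x <= W y.
  move=> x0 yl xy; apply: (is_derive_nondecreasing (f := W) xy) => z /andP[xz zy].
    by apply: dW; rewrite (le_trans x0 xz) (le_trans zy yl).
  by apply: dWp; rewrite (le_lt_trans x0 xz) (lt_le_trans zy yl).
have Wz x : 0 < x < ell -> W x = 0.
  move=> /andP[x0 xl]; apply/eqP; rewrite eq_le -{1}Wl -W0.
  by rewrite !mono // ltW.
move=> x xl; have xl' : 0 <= x <= ell by case/andP: xl => *; rewrite !ltW.
have /eqP := is_derive_locally0 xl Wz (dW _ xl').
have nz : w ^+ 2 * D ^+ 2 * dn x != 0.
  apply: mulf_neq0; last exact/lt0r_neq0/(dn_gt0 J).
  by apply: mulf_neq0; rewrite sqrf_eq0 // gt_eqF.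
by rewrite mulrA mulf_eq0 (negbTE nz) => /eqP.
Qed.

Let uc x : 0 <= x <= ell -> {for x, continuous u}.
Proof. by move=> /S[ux _]; exact: is_derive_continuous ux. Qed.

(** Otherwise [u] has at most one zero in the open half period.  If it keeps its
    sign, the constant with this sign contradicts orthogonality; if it changes
    sign at its zero [z], a multiple of [sn(z)^2 - sn^2] has the sign of [u] on
    both sides, since [sn] is increasing. *)
Lemma lame_neumann : D != 0 -> forall x, 0 <= x <= ell -> u x = 0.
Proof.
move=> D0; apply: contrapT => NZ.
have orth := fun q0 q1 => @lame_orthogonal q0 q1 D0.
have sn_lt x y : 0 <= x -> x < y -> y <= ell -> sn x < sn y.
  move=> x0 xy yl; apply: (is_derive_increasing (f := sn) xy) => z /andP[xz zy].
    exact: sn_deriv J z.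
  have zl : 0 < z < ell by rewrite (le_lt_trans x0 xz) (lt_le_trans zy yl).
  by rewrite !mulr_gt0 ?cnp ?(dn_gt0 J).
have sgn (a b : R) : 0 <= a -> b <= ell -> (forall x, a < x < b -> u x != 0) ->
    forall x y, a < x < b -> a < y < b -> 0 < u x * u y.
  move=> a0 bl; apply: constant_sign => x /andP[ax xb]; apply: uc.
  by rewrite !ltW ?(le_lt_trans a0 ax) ?(lt_le_trans xb bl).
have [[z [zl uz]]|nz] := pselect (exists z, 0 < z < ell /\ u z = 0); last first.
  have hl : 0 < ell / 2 < ell by move: ell0; lra.
  have nz' x : 0 < x < ell -> u x != 0.
    by move=> xl; apply/eqP => ux; apply: nz; exists x.
  have := orth (u (ell / 2)) 0 _ (ell / 2) hl.
  rewrite mul0r addr0 => H; have /eqP : u (ell / 2) * u (ell / 2) = 0.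
    by apply: H => x xl; rewrite mul0r addr0 ltW // (sgn 0 ell).
  by rewrite mulf_eq0 orbb (negbTE (nz' _ hl)).
have [z0 zl'] := andP zl.
have nz x : 0 < x < ell -> x != z -> u x != 0.
  move=> /andP[x0 xl] xz; apply/eqP => ux; apply: NZ.
  move: xz; rewrite neq_lt => /orP[xz|zx].
    exact: lame_one_zero x0 xz zl' ux uz.
  exact: lame_one_zero z0 zx xl uz ux.
pose x1 := z / 2; pose x2 := (z + ell) / 2.
have x1z : 0 < x1 < z by rewrite /x1; lra.
have x2z : z < x2 < ell by rewrite /x2; lra.
have x1l : 0 < x1 < ell by rewrite /x1; lra.
have sgl x y : 0 < x < z -> 0 < y < z -> 0 < u x * u y.
  apply: sgn => // [|t /andP[t0 tz]]; first exact: ltW.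
  by apply: nz; rewrite ?t0 ?(lt_trans tz zl') // lt_eqF.
have sgr x y : z < x < ell -> z < y < ell -> 0 < u x * u y.
  apply: sgn => // [|t /andP[zt tl]]; first exact: ltW.
  by apply: nz; rewrite ?tl ?(lt_trans z0 zt) // gt_eqF.
have u1n : u x1 != 0.
  by apply: nz => //; rewrite lt_eqF //; case/andP: x1z.
have u2n : u x2 != 0.
  by apply: nz; rewrite ?gt_eqF //; case/andP: x2z => // *; rewrite (lt_trans z0).
case: (ltgtP (u x1 * u x2) 0) => [neg|pos|/eqP]; last first.
- by rewrite mulf_eq0 (negbTE u1n) (negbTE u2n).
- have := orth (u x1) 0 _ x1 x1l.
  rewrite mul0r addr0 => H; have /eqP : u x1 * u x1 = 0.
    apply: H => x /andP[x0 xl]; rewrite mul0r addr0.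
    case: (ltgtP x z) => [xz|zx|->]; last by rewrite uz mul0r.
      by rewrite ltW // sgl // x0.
    have h2 : 0 < u x * u x2 by rewrite sgr // zx.
    have h3 : 0 < u x2 ^+ 2 by rewrite lt0r sqrf_eq0 u2n sqr_ge0.
    by rewrite -(pmulr_lge0 _ h3); move: (mulr_gt0 h2 pos); nra.
  by rewrite mulf_eq0 orbb (negbTE u1n).
have ss x : 0 < x < ell -> (x < z -> sn x ^+ 2 < sn z ^+ 2) /\ (z < x -> sn z ^+ 2 < sn x ^+ 2).
  move=> /[dup] xl /andP[x0 xl']; have := snp zl; have := snp xl => sx sz.
  by split=> xz; rewrite ltr_pXn2r ?nnegrE ?ltW // sn_lt // ltW.
have := orth (u x1 * sn z ^+ 2) (- u x1) _ x1 x1l.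
have E x : u x1 * sn z ^+ 2 + - u x1 * sn x ^+ 2 = u x1 * (sn z ^+ 2 - sn x ^+ 2) by ring.
rewrite E => H; have /eqP : u x1 * (u x1 * (sn z ^+ 2 - sn x1 ^+ 2)) = 0.
  apply: H => x xl; have [s1 s2] := ss x xl; rewrite E mulrA.
  case: (ltgtP x z) => [xz|zx|->]; last by rewrite uz !mul0r.
    rewrite mulr_ge0 ?subr_ge0 ?(ltW (s1 xz)) // ltW // sgl //.
    by case/andP: xl => ->.
  rewrite mulr_le0 ?subr_le0 ?(ltW (s2 zx)) //.
  have h2 : 0 < u x * u x2 by rewrite sgr // zx; case/andP: xl.
  have h3 : 0 < u x2 ^+ 2 by rewrite lt0r sqrf_eq0 u2n sqr_ge0.
  rewrite -(pmulr_lle0 _ h3).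
  have -> : u x * u x1 * u x2 ^+ 2 = (u x * u x2) * (u x1 * u x2) by ring.
  by rewrite pmulr_rle0 // ltW.
have [s1 _] := ss _ x1l; rewrite !mulf_eq0 (negbTE u1n) /= subr_eq0.
by rewrite gt_eqF // s1 //; case/andP: x1z.
Qed.

End Neumann.

(** With respect to the reflection [x -> 2 ell - x] the odd part satisfies
    Dirichlet conditions on [[0, ell]] and vanishes; the even part satisfies
    Neumann conditions.  Hence [u] is even, [D = 0], and [u] agrees with the
    multiple of [lame_ground] that has the same value at [0]. *)
Lemma lame_periodic u u1 : solves p u u1 0 (2 * ell) ->
  u 0 = u (2 * ell) -> u1 0 = u1 (2 * ell) ->
  (exists2 x : R, 0 <= x <= 2 * ell & u x != 0) ->
  D = 0 /\ exists a, forall x, 0 <= x <= 2 * ell -> u x = a * lame_ground m sn dn h x.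
Proof.
move=> S up u1p [x2 x2l ux2].
have prefl x : p (2 * ell - x) = p x by rewrite /p /lame_pot snr.
pose rf x := 2 * ell - x.
have rfl x : 0 <= x <= 2 * ell -> 0 <= rf x <= 2 * ell by rewrite /rf; lra.
have drf x : is_derive x 1 rf (-1) by rewrite /rf; der; ring.
have S2 : solves p (fun x => u (rf x)) (fun x => - u1 (rf x)) 0 (2 * ell).
  move=> x /rfl /S[h1 h2]; split.
    have H := is_derive_compE h1 (drf x); eapply is_derive_eq; [exact: H|ring].
  have H := is_deriveNE (is_derive_compE h2 (drf x)).
  by eapply is_derive_eq; [exact: H|rewrite /rf prefl; ring].
pose o x := u x - u (rf x); pose o1 x := u1 x + u1 (rf x).
pose e x := u x + u (rf x); pose e1 x := u1 x - u1 (rf x).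
have So : solves p o o1 0 (2 * ell).
  move=> x xl; have [h1 h2] := S x xl; have [h3 h4] := S2 x xl.
  split; eapply is_derive_eq.
  - exact: (is_deriveDE h1 (is_deriveNE h3)).
  - by rewrite /o1 /=; ring.
  - have -> : o1 = (fun y => u1 y + - - u1 (rf y)).
      by apply/funext => y; rewrite opprK.
    exact: (is_deriveDE h2 (is_deriveNE h4)).
  - by rewrite /o /=; ring.
have Se : solves p e e1 0 (2 * ell).
  move=> x xl; have [h1 h2] := S x xl; have [h3 h4] := S2 x xl.
  split; eapply is_derive_eq.
  - exact: (is_deriveDE h1 h3).
  - by rewrite /e1 /=; ring.
  - exact: (is_deriveDE h2 h4).
  - by rewrite /e /=; ring.
have half : ell <= 2 * ell by move: ell0; lra.
have rf0 : rf 0 = 2 * ell by rewrite /rf subr0.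
have rfe : rf ell = ell by rewrite /rf; ring.
have o0 : forall x, 0 <= x <= ell -> o x = 0.
  apply: (lame_dirichlet (solvesW (lexx _) half So)).
    by rewrite /o rf0 up subrr.
  by rewrite /o rfe subrr.
have sym x : 0 <= x <= 2 * ell -> u (rf x) = u x.
  move=> /andP[y0 yl]; have [xl|lx] := leP x ell.
    by apply/esym/eqP; rewrite -subr_eq0; apply/eqP/o0; rewrite y0.
  apply/eqP; rewrite -subr_eq0; apply/eqP.
  have <- : o (rf x) = u (rf x) - u x by rewrite /o /rf; congr (_ - u _); ring.
  by apply: o0; rewrite /rf; lra.
have e10 : e1 0 = 0 by rewrite /e1 rf0 u1p subrr.
have e1l : e1 ell = 0 by rewrite /e1 rfe subrr.
have Se' := solvesW (lexx 0) half Se.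
have eu x : 0 <= x <= 2 * ell -> e x = 2 * u x by move=> /sym; rewrite /e => ->; ring.
have ext f : (forall x, f (rf x) = f x) -> (forall x, 0 <= x <= ell -> u x = f x) ->
    forall x, 0 <= x <= 2 * ell -> u x = f x.
  move=> fr uf x /[dup] xl /andP[y0 yl]; have [xe|lx] := leP x ell.
    by apply: uf; rewrite y0.
  by rewrite -sym // -fr; apply: uf; rewrite /rf; lra.
have D0 : D = 0.
  apply/eqP; apply: contraTT ux2 => D0; rewrite negbK; apply/eqP.
  apply: (ext (fun=> 0)) => // x /andP[y0 yl].
  have := lame_neumann Se' e10 e1l D0 (x := x).
  rewrite eu ?y0 ?yl ?(le_trans yl half) // => /(_ isT) /eqP.
  by rewrite mulf_eq0 pnatr_eq0 /= => /eqP.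
split => //; pose f := lame_ground m sn dn h; pose f1 := lame_ground1 w m sn cn dn h.
have f0 : f 0 = 24 * dn 0 by rewrite /f /lame_ground /lame_fun sn0; ring.
have f0n : f 0 != 0 by rewrite f0 mulf_neq0 ?gt_eqF ?(dn_gt0 J).
pose a := u 0 / f 0; exists a; apply: ext => [x|].
  by rewrite /rf /lame_ground /lame_fun snr dnr.
move=> x xl; pose v y := e y - 2 * a * f y; pose v1 y := e1 y - 2 * a * f1 y.
have Sv : solves p v v1 0 ell.
  move=> y /Se'[h1 h2]; have h3 : is_derive y 1 f (f1 y) := is_derive_lame_fun J _ _ _ y.
  have h4 := is_derive_lame_ground1 J y D0; rewrite -/f1 -/f -/p in h4.
  by split; rewrite /v /v1; der; ring.
have v00 : v 0 = 0.
  rewrite /v eu; last by rewrite lexx (le_trans (ltW ell0) half).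
  by rewrite /a; field.
have v10 : v1 0 = 0 by rewrite /v1 e10 /f1 /lame_ground1 /lame_fun1 sn0; ring.
have ell00 : (0 : R) <= 0 <= ell by apply/andP; split => //; exact: ltW.
have := solves_unique ell00 (fun x _ => pM x) Sv v00 v10 xl.
rewrite /v eu; last by case/andP: xl => -> /= /le_trans -> //.
by rewrite -/f => /eqP; rewrite -mulrA -mulrBr mulf_eq0 pnatr_eq0 /= subr_eq0 => /eqP.
Qed.

End LamePeriodic.

(** * The Jacobi functions and the complete elliptic integral *)

Section Amplitude.
Context {R : realType}.
Implicit Types x u : R.
Variable k : R.
Hypothesis k01 : 0 < k < 1.

Let k2 : 0 < k ^+ 2 < 1.
Proof. by case/andP: k01 => k0 k1; rewrite exprn_gt0 //= exprn_ilt1 // ltW. Qed.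

Lemma sin_sqr_le1 x : sin x ^+ 2 <= 1.
Proof. by have := sqr_ge0 (cos x); rewrite cos2sin2 subr_ge0. Qed.

Lemma delta_gt0 x : 0 < 1 - k ^+ 2 * sin x ^+ 2.
Proof.
have := sin_sqr_le1 x; have := sqr_ge0 (sin x); case/andP: k2 => h1 h2 h3 h4.
by rewrite subr_gt0 (le_lt_trans _ h2) // ger_pMr.
Qed.

Lemma is_derive_delta (t : R -> R) x (a : R) : is_derive x 1 t a ->
  is_derive x 1 (fun y => Num.sqrt (1 - k ^+ 2 * sin (t y) ^+ 2))
    (- (k ^+ 2 * sin (t x) * cos (t x) * a / Num.sqrt (1 - k ^+ 2 * sin (t x) ^+ 2))).
Proof.
move=> ta; have h : is_derive x 1 (fun y : R => 1 - k ^+ 2 * sin (t y) ^+ 2)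
   (- (2 * k ^+ 2 * sin (t x) * cos (t x) * a)) by der; ring.
have H := is_derive_sqrtE (f := fun y => 1 - k ^+ 2 * sin (t y) ^+ 2) (delta_gt0 (t x)) h; eapply is_derive_eq; first exact: H.
have s0 : Num.sqrt (1 - k ^+ 2 * sin (t x) ^+ 2) != 0 by rewrite gt_eqF // sqrtr_gt0 delta_gt0.
by field.
Qed.

Lemma ellip_dens_ge1 x : 1 <= ellip_dens k x.
Proof.
rewrite /ellip_dens invf_ge1 ?sqrtr_gt0 ?delta_gt0 //.
rewrite -[leRHS]sqrtr1 ler_sqrt // gerBl mulr_ge0 ?sqr_ge0 //.
Qed.

Lemma ellip_dens_continuous : continuous (ellip_dens k).
Proof.
move=> x; have d0 : Num.sqrt (1 - k ^+ 2 * sin x ^+ 2) != 0.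
  by rewrite gt_eqF // sqrtr_gt0 delta_gt0.
have := is_deriveVE (f := fun y : R => Num.sqrt (1 - k ^+ 2 * sin y ^+ 2)) d0
  (is_derive_delta (is_derive_idE x)).
exact: is_derive_continuous.
Qed.

Lemma is_derive_ellipF x : is_derive x 1 (ellipF k) (ellip_dens k x).
Proof. exact: (is_derive_oint x ellip_dens_continuous). Qed.

Lemma ellipF0 : ellipF k 0 = 0.
Proof. exact: oint0. Qed.

Lemma ellipF_pi2 : ellipF k (pi / 2) = ellipK k.
Proof. by rewrite /ellipF divr_ge0 // pi_ge0. Qed.

Lemma ellipF_lt : {mono ellipF k : x y / x < y}.
Proof.
apply: leW_mono; apply: le_mono => x y xy.
apply: (is_derive_increasing (f := ellipF k) xy) => z _.
  exact: is_derive_ellipF.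
exact: lt_le_trans ltr01 (ellip_dens_ge1 z).
Qed.

Lemma ellipF_inj : injective (ellipF k).
Proof. by move=> x y e; case: (ltgtP x y) => //; rewrite -ellipF_lt e ltxx. Qed.

(** The density is at least [1], so [ellipF k] grows at least like the
    identity. *)
Lemma ellipF_surj u : exists x, ellipF k x = u.
Proof.
have grow x y : x <= y -> ellipF k x - x <= ellipF k y - y.
  move=> xy; apply: (is_derive_nondecreasing (f := fun x => ellipF k x - x) xy) => z _.
    exact: is_deriveDE (is_derive_ellipF z) (is_deriveNE (is_derive_idE z)).
  by rewrite /= subr_ge0 ellip_dens_ge1.
have [|||x _ <-] := @IVT R (ellipF k) (- `|u|) `|u| u; last by exists x.
- by have := normr_ge0 u; lra.
- apply/continuous_subspaceT => x; exact: is_derive_continuous (is_derive_ellipF x).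
have := grow 0 `|u| (normr_ge0 u); have : - `|u| <= 0 by rewrite oppr_le0.
move=> /grow; rewrite ellipF0 subr0 => h1 h2.
have := ler_norm u; have := ler_norm (- u); rewrite normrN => h3 h4.
by rewrite ge_min le_max; apply/andP; split; apply/orP; [left|right]; lra.
Qed.

Lemma jacobi_amK u : ellipF k (jacobi_am k u) = u.
Proof. exact: (xgetPex 0 (ellipF_surj u)). Qed.

Lemma ellipFK x : jacobi_am k (ellipF k x) = x.
Proof. by apply: ellipF_inj; rewrite jacobi_amK. Qed.

Lemma is_derive_jacobi_am u : is_derive u 1 (jacobi_am k)
  (Num.sqrt (1 - k ^+ 2 * sin (jacobi_am k u) ^+ 2)).
Proof.
have := @is_derive_inverse R (ellipF k) (jacobi_am k) _ (jacobi_am k u) _ _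
  (is_derive_ellipF (jacobi_am k u)).
rewrite jacobi_amK /ellip_dens invrK; apply.
- by near=> x; exact: ellipFK.
- by near=> x; exact: is_derive_continuous (is_derive_ellipF x).
- by rewrite gt_eqF // invr_gt0 sqrtr_gt0 delta_gt0.
Unshelve. all: by end_near. Qed.

(** The sum of the two values has zero derivative, and equals [2 K] at
    [pi / 2]. *)
Lemma ellipF_reflect x : ellipF k (pi - x) = 2 * ellipK k - ellipF k x.
Proof.
have d (z : R) : is_derive z 1 (fun y : R => ellipF k (pi - y) + ellipF k y) 0.
  have h1 : is_derive z 1 (fun y : R => pi - y) (-1) by der; ring.
  have := is_deriveDE (is_derive_compE (g := fun y : R => pi - y) (is_derive_ellipF (pi - z)) h1)
    (is_derive_ellipF z).
  move=> H; eapply is_derive_eq; first exact: H.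
  by rewrite /ellip_dens sinB sinpi cospi; rewrite mul0r sub0r mulN1r opprK; ring.
have := is_derive_0_is_cst x (pi / 2) d.
have -> : pi - pi / 2 = pi / 2 :> R by field.
by rewrite ellipF_pi2 => /eqP; rewrite -subr_eq => /eqP H; lra.
Qed.

Lemma jacobi_am_reflect u : jacobi_am k (2 * ellipK k - u) = pi - jacobi_am k u.
Proof. by apply: ellipF_inj; rewrite ellipF_reflect !jacobi_amK. Qed.

Lemma ellipF_shift x : ellipF k (x + pi) = ellipF k x + 2 * ellipK k.
Proof.
have d (z : R) : is_derive z 1 (fun y : R => ellipF k (y + pi) - ellipF k y) 0.
  have h1 : is_derive z 1 (fun y : R => y + pi) 1 by der; ring.
  have := is_deriveDE (is_derive_compE (g := fun y : R => y + pi) (is_derive_ellipF (z + pi)) h1)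
    (is_deriveNE (is_derive_ellipF z)).
  move=> H; eapply is_derive_eq; first exact: H.
  by rewrite /ellip_dens sinDpi sqrrN; ring.
have := is_derive_0_is_cst x 0 d.
have := ellipF_reflect 0; rewrite add0r subr0 ellipF0 subr0.
by lra.
Qed.

Lemma jacobi_am_shift u : jacobi_am k (u + 2 * ellipK k) = jacobi_am k u + pi.
Proof. by apply: ellipF_inj; rewrite ellipF_shift !jacobi_amK. Qed.

Lemma ellipK_gt0 : 0 < ellipK k.
Proof. by rewrite -ellipF_pi2 -ellipF0 ellipF_lt divr_gt0 // pi_gt0. Qed.

Variable L : R.
Hypothesis L0 : 0 < L.

Let th x := jacobi_am k (2 * ellipK k / L * x).
Let w := 2 * ellipK k / L.

Definition per_sn x := sin (th x).
Definition per_cn x := jacobi_cn (2 * ellipK k / L * x) k.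
Definition per_dn x := Num.sqrt (1 - k ^+ 2 * sin (th x) ^+ 2).

Let dth x : is_derive x 1 th (w * per_dn x).
Proof.
have h1 : is_derive x 1 (fun y : R => 2 * ellipK k / L * y) w by rewrite /w; der; ring.
have H := is_derive_compE (g := fun y : R => 2 * ellipK k / L * y)
  (is_derive_jacobi_am (2 * ellipK k / L * x)) h1.
by eapply is_derive_eq; [exact: H|rewrite mulrC].
Qed.

Lemma per_jacobi : jacobi_triple w (k ^+ 2) per_sn per_cn per_dn.
Proof.
split=> x; have h := dth x.
- by rewrite /per_sn; der; rewrite /per_cn /jacobi_cn -/(th x); ring.
- by rewrite /per_cn /jacobi_cn -/th; der; rewrite /per_sn; ring.
- have H := is_derive_delta h; eapply is_derive_eq; first exact: H.
  have s0 : per_dn x != 0 by rewrite gt_eqF // sqrtr_gt0 delta_gt0.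
  by rewrite -/(per_dn x) /per_sn /per_cn /jacobi_cn -/(th x); field.
- by rewrite /per_cn /per_sn /jacobi_cn -/(th x) cos2sin2.
- by rewrite /per_dn /per_sn sqr_sqrtr // ltW // delta_gt0.
- by rewrite sqrtr_gt0 delta_gt0.
Qed.

Let th_half : th (L / 2) = pi / 2.
Proof.
rewrite /th -[RHS]ellipFK ellipF_pi2; congr (jacobi_am _ _).
by field; exact: lt0r_neq0.
Qed.

Let th0 : th 0 = 0.
Proof. by rewrite /th mulr0 -[RHS]ellipFK ellipF0. Qed.

Let th_refl x : th (2 * (L / 2) - x) = pi - th x.
Proof.
rewrite /th -jacobi_am_reflect; congr (jacobi_am _ _).
by field; exact: lt0r_neq0.
Qed.

Let th_shift x : th (x + L) = th x + pi.
Proof.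
rewrite /th -jacobi_am_shift; congr (jacobi_am _ _).
by field; exact: lt0r_neq0.
Qed.

Let th_lt x y : x < y -> th x < th y.
Proof.
move=> xy; rewrite -ellipF_lt !jacobi_amK ltr_pM2l //.
by rewrite divr_gt0 // mulr_gt0 // ellipK_gt0.
Qed.

Lemma per_freq_gt0 : 0 < w.
Proof. by rewrite divr_gt0 // mulr_gt0 // ellipK_gt0. Qed.

Lemma per_sn0 : per_sn 0 = 0.
Proof. by rewrite /per_sn th0 sin0. Qed.

Lemma per_cn_half : per_cn (L / 2) = 0.
Proof. by rewrite /per_cn /jacobi_cn -/(th _) th_half cos_pihalf. Qed.

Lemma per_sn_gt0 x : 0 < x < L / 2 -> 0 < per_sn x.
Proof.
move=> /andP[x0 xl]; apply: sin_gt0_pi.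
rewrite -{1}th0 th_lt //= (lt_trans (th_lt xl)) // th_half.
by have := pi_gt0 R; lra.
Qed.

Lemma per_cn_gt0 x : 0 < x < L / 2 -> 0 < per_cn x.
Proof.
move=> /andP[x0 xl]; apply: cos_gt0_pihalf; rewrite -/(th x) -th_half th_lt // andbT.
rewrite th_half (lt_trans (y := th 0)) ?th_lt // th0.
by have := pi_gt0 R; lra.
Qed.

Lemma per_sn_refl x : per_sn (2 * (L / 2) - x) = per_sn x.
Proof. by rewrite /per_sn th_refl sinB sinpi cospi mul0r sub0r mulN1r opprK. Qed.

Lemma per_dn_refl x : per_dn (2 * (L / 2) - x) = per_dn x.
Proof. by have := per_sn_refl x; rewrite /per_dn /per_sn => ->. Qed.

Lemma per_sn_shift x : per_sn (x + L) = - per_sn x.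
Proof. by rewrite /per_sn th_shift sinDpi. Qed.

Lemma per_cn_shift x : per_cn (x + L) = - per_cn x.
Proof. by rewrite /per_cn /jacobi_cn -!/(th _) th_shift cosDpi. Qed.

Lemma per_dn_shift x : per_dn (x + L) = per_dn x.
Proof. by have := per_sn_shift x; rewrite /per_dn /per_sn => ->; rewrite sqrrN. Qed.

End Amplitude.

Section Monotonicity.
Context {R : realType}.

(** With [s = sin(t)^2], the sum of the elliptic densities at the angles [t] and
    [pi/2 - t].  Multiplied by the fourth root of [m^2 - m + 1], this sum increases
    with [m] at every angle, which the density alone does not. *)
Definition symm_dens (m s : R) : R :=
  (Num.sqrt (1 - m * s))^-1 + (Num.sqrt (1 - m * (1 - s)))^-1.

(** Put [P = (1 - m s)(1 - m (1 - s)) = 1 - m + m^2 t] with [t = s (1 - s)], which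
    is at most [1/4].  Then [symm_dens^2 sqrt q = X (Y + 2)], where [X^2 = q / P]
    and [Y^2 = (2 - m)^2 / P].  Comparing cross products, [X^2] increases and
    [Y^2] does not decrease in [m], as the differences have the factor
    [(m2 - m1)(m2 + m1 - m1 m2)]. *)
Lemma symm_dens_lt (m1 m2 s : R) : 0 < m1 -> m1 < m2 -> m2 < 1 -> 0 <= s <= 1 ->
  symm_dens m1 s ^+ 2 * Num.sqrt (m1 ^+ 2 - m1 + 1) <
  symm_dens m2 s ^+ 2 * Num.sqrt (m2 ^+ 2 - m2 + 1).
Proof.
move=> m10 m12 m21 /andP[s0 s1].
pose A m := symm_dens m s; pose q (m : R) : R := Num.sqrt (m ^+ 2 - m + 1).
rewrite -/(A m1) -/(A m2) -/(q m1) -/(q m2).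
pose t := s * (1 - s); pose P (m : R) := 1 - m + m ^+ 2 * t.
have t0 : 0 <= t by rewrite mulr_ge0 // subr_ge0.
have t4 : 0 <= 1 - 4 * t by rewrite /t; have := sqr_ge0 (1 - 2 * s); nra.
have key : 0 < (m2 - m1) * (m2 + m1 - m1 * m2) by rewrite mulr_gt0 ?subr_gt0 //; nra.
have Pp (m : R) : 0 < m -> m < 1 -> 0 < P m by move=> m0 mm; rewrite /P; have := mulr_ge0 (sqr_ge0 m) t0; lra.
have qp (m : R) : 0 < m -> m < 1 -> 0 < m ^+ 2 - m + 1 by move=> m0 mm; have := sqr_ge0 m; lra.
pose X (m : R) : R := q m / Num.sqrt (P m); pose Y (m : R) : R := (2 - m) / Num.sqrt (P m).
have Xp (m : R) : 0 < m -> m < 1 -> 0 < X m.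
  by move=> m0 mm; rewrite divr_gt0 // sqrtr_gt0 ?qp ?Pp.
have Yp (m : R) : 0 < m -> m < 1 -> 0 < Y m.
  move=> m0 mm; rewrite divr_gt0 // ?sqrtr_gt0 ?Pp //; lra.
have AE (m : R) : 0 < m -> m < 1 -> A m ^+ 2 * q m = X m * (Y m + 2).
  move=> m0 mm; rewrite /X /Y.
  have h1 : 0 < 1 - m * s by nra.
  have h2 : 0 < 1 - m * (1 - s) by nra.
  have -> : P m = (1 - m * s) * (1 - m * (1 - s)) by rewrite /P /t; ring.
  rewrite sqrtrM ?(ltW h1) // /A /symm_dens.
  have n1 : Num.sqrt (1 - m * s) != 0 by rewrite gt_eqF // sqrtr_gt0.
  have n2 : Num.sqrt (1 - m * (1 - s)) != 0 by rewrite gt_eqF // sqrtr_gt0.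
  have e1 := sqr_sqrtr (ltW h1); have e2 := sqr_sqrtr (ltW h2).
  have -> : 2 - m = Num.sqrt (1 - m * s) ^+ 2 + Num.sqrt (1 - m * (1 - s)) ^+ 2.
    by rewrite e1 e2; ring.
  by field; rewrite n1 n2.
have m11 := lt_trans m12 m21; have m20 := lt_trans m10 m12.
have XX : X m1 < X m2.
  rewrite -(ltr_pXn2r (n := 2)) ?nnegrE ?(ltW (Xp _ _ _)) // !expr_div_n.
  rewrite !sqr_sqrtr ?(ltW (qp _ _ _)) ?(ltW (Pp _ _ _)) //.
  rewrite ltr_pdivrMr ?Pp // mulrAC ltr_pdivlMr ?Pp // -subr_gt0.
  have -> : (m2 ^+ 2 - m2 + 1) * P m1 - (m1 ^+ 2 - m1 + 1) * P m2 =
    (1 - t) * ((m2 - m1) * (m2 + m1 - m1 * m2)) by rewrite /P; ring.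
  by rewrite mulr_gt0 //; lra.
have YY : Y m1 <= Y m2.
  rewrite -(ler_pXn2r (n := 2)) ?nnegrE ?(ltW (Yp _ _ _)) // !expr_div_n.
  rewrite !sqr_sqrtr ?(ltW (Pp _ _ _)) //.
  rewrite ler_pdivrMr ?Pp // mulrAC ler_pdivlMr ?Pp // -subr_ge0.
  have -> : (2 - m2) ^+ 2 * P m1 - (2 - m1) ^+ 2 * P m2 =
    (1 - 4 * t) * ((m2 - m1) * (m2 + m1 - m1 * m2)) by rewrite /P; ring.
  by rewrite mulr_ge0 // ltW.
rewrite !AE //; apply: (@lt_le_trans _ _ (X m2 * (Y m1 + 2))).
  by rewrite ltr_pM2r // addr_gt0 // Yp.
by rewrite ler_pM2l ?Xp // lerD2r.
Qed.

(** The pointwise inequality between symmetrized densities, integrated over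
    [[0, pi/2]].  The integral appears as the increment of
    [ellipF k x - ellipF k (pi/2 - x)], whose values at the ends are [- K]
    and [K]. *)
Lemma gfun_lt (k1 k2 : R) : 0 < k1 -> k1 < k2 -> k2 < 1 -> gfun k1 < gfun k2.
Proof.
move=> k10 k12 k21; have k20 := lt_trans k10 k12; have k11 := lt_trans k12 k21.
pose m1 := k1 ^+ 2; pose m2 := k2 ^+ 2.
have m10 : 0 < m1 by rewrite exprn_gt0.
have m12 : m1 < m2 by rewrite ltr_pXn2r // nnegrE ltW.
have m21 : m2 < 1 by rewrite exprn_ilt1 // ltW.
have q0 (m : R) : 0 < m -> m < 1 -> 0 < m ^+ 2 - m + 1.
  by move=> m0 mm; have := sqr_ge0 m; lra.
pose q (m : R) : R := Num.sqrt (m ^+ 2 - m + 1).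
have q1p : 0 < q m1 by rewrite sqrtr_gt0 q0 // (lt_trans m12 m21).
have q2p : 0 < q m2 by rewrite sqrtr_gt0 q0 // (lt_trans m10 m12).
(* The fourth root of the ratio of the values of [m^2 - m + 1]. *)
pose la := Num.sqrt (q m1 / q m2).
have la0 : 0 < la by rewrite sqrtr_gt0 divr_gt0.
have la2 : la ^+ 2 * q m2 = q m1.
  by rewrite sqr_sqrtr ?divr_ge0 ?ltW // divfK // gt_eqF.
have k1b : 0 < k1 < 1 by rewrite k10. have k2b : 0 < k2 < 1 by rewrite k20.
have symE (k x : R) : ellip_dens k x + ellip_dens k (pi / 2 - x) = symm_dens (k ^+ 2) (sin x ^+ 2).
  rewrite /ellip_dens /symm_dens sinB sin_pihalf cos_pihalf mul1r mul0r subr0.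
  by rewrite cos2sin2.
have dens_lt (x : R) : la * symm_dens m1 (sin x ^+ 2) < symm_dens m2 (sin x ^+ 2).
  have s01 : 0 <= sin x ^+ 2 <= 1 by rewrite sqr_ge0 sin_sqr_le1.
  have := symm_dens_lt m10 m12 m21 s01; rewrite -/(q m1) -/(q m2) -la2 mulrA.
  rewrite ltr_pM2r // -exprMn mulrC ltr_pXn2r //.
    rewrite nnegrE mulr_ge0 ?(ltW la0) // addr_ge0 // invr_ge0 sqrtr_ge0 //.
  by rewrite nnegrE addr_ge0 // invr_ge0 sqrtr_ge0.
pose G (k x : R) : R := ellipF k x - ellipF k (pi / 2 - x).
have dG (k x : R) : 0 < k < 1 -> is_derive x 1 (G k) (symm_dens (k ^+ 2) (sin x ^+ 2)).
  move=> kb; have h1 : is_derive x 1 (fun y : R => pi / 2 - y) (-1) by der; ring.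
  have H := is_deriveDE (is_derive_ellipF kb x) (is_deriveNE
    (is_derive_compE (g := fun y : R => pi / 2 - y) (is_derive_ellipF kb (pi / 2 - x)) h1)).
  by eapply is_derive_eq; [exact: H|rewrite -symE mulrN1 opprK].
pose F (x : R) : R := G k2 x - la * G k1 x.
have F_lt : F 0 < F (pi / 2).
  apply: (is_derive_increasing (f := F) (df := fun x => symm_dens m2 (sin x ^+ 2)
      - la * symm_dens m1 (sin x ^+ 2))) => [|x _|x _]; last by rewrite subr_gt0.
    by rewrite divr_gt0 // pi_gt0.
  have h1 := dG k1 x k1b; have h2 := dG k2 x k2b.
  by rewrite /F; der; rewrite /m1 /m2; ring.
have KK : la * ellipK k1 < ellipK k2.
  move: F_lt; rewrite /F /G !subrr !subr0 !ellipF0 !ellipF_pi2; lra.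
have q_eq (k : R) : Num.sqrt (k ^+ 4 - k ^+ 2 + 1) = q (k ^+ 2).
  by rewrite /q -exprM.
have K0 := ellipK_gt0 k1b; have K0' := ellipK_gt0 k2b.
have KK2 : ellipK k1 ^+ 2 * q m1 < ellipK k2 ^+ 2 * q m2.
  rewrite -la2 mulrA ltr_pM2r // mulrC -exprMn.
  by rewrite ltr_pXn2r // nnegrE ltW // mulr_gt0.
by rewrite /gfun !q_eq -/m1 -/m2; move: KK2; lra.
Qed.

End Monotonicity.

(** * Convergence of integrals and smooth periodic test functions *)

Section Convergence.
Context {R : realType}.
Notation mu := (@lebesgue_measure R).

Lemma ae_imp (P Q : set R) : P `<=` Q -> {ae mu, forall x, P x} ->
  {ae mu, forall x, Q x}.
Proof.
by move=> PQ; apply: filterS; first exact: (ae_filter_ringOfSetsType mu).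
Qed.

Lemma ae_and (P Q : set R) : {ae mu, forall x, P x} -> {ae mu, forall x, Q x} ->
  {ae mu, forall x, P x /\ Q x}.
Proof.
by move=> p q; apply: filterI; first exact: (ae_filter_ringOfSetsType mu).
Qed.

Lemma Rintegral_mul_cvg (D : set R) (g : R -> R) (h_ : nat -> R -> R) (h : R -> R) (C : R) :
  measurable D -> mu.-integrable D (EFin \o g) ->
  (forall n, measurable_fun D (h_ n)) -> measurable_fun D h ->
  (forall n x, D x -> `|h_ n x| <= C) ->
  {ae mu, forall x, D x -> h_ n x @[n --> \oo] --> h x} ->
  (\int[mu]_(x in D) (g x * h_ n x)) @[n --> \oo] --> \int[mu]_(x in D) (g x * h x).
Proof.
move=> mD gi mh_ mh hC hc.
have mg : measurable_fun D g by case/integrableP : gi => /measurable_EFinP.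
have [||||| i _ H] := @dominated_convergence _ _ R mu D mD
  (fun n x => (g x * h_ n x)%:E) (fun x => (g x * h x)%:E)
  (fun x => (`|g x| * C)%:E).
- by move=> n; apply/measurable_EFinP; exact: measurable_funM mg (mh_ n).
- apply/measurable_EFinP; exact: measurable_funM mg mh.
- apply: ae_imp hc => x hx Dx; apply: cvg_EFin; first exact: nearW.
  by apply: cvgMr; exact: hx.
- have gn : mu.-integrable D (EFin \o (fun x => `|g x|)) by exact: integrable_norm.
  have := @integrableZl _ _ _ mu D mD C _ gn; apply: eq_integrable => // x _ /=.
  by rewrite -EFinM mulrC.
- apply: aeW => x n Dx; rewrite /= lee_fin normrM ler_wpM2l //.
  exact: hC.
apply: fine_cvg; rewrite fineK //; exact: integrable_fin_num.
Qed.

Lemma Rintegral_ae_eq (D : set R) (f g : R -> R) : measurable D ->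
  measurable_fun D f -> measurable_fun D g ->
  f = g %[ae mu in D] -> \int[mu]_(x in D) f x = \int[mu]_(x in D) g x.
Proof.
move=> mD mf mg fg; congr fine; apply: ae_eq_integral => //.
- exact/measurable_EFinP.
- exact/measurable_EFinP.
- by apply: ae_imp fg => x h Dx; rewrite h.
Qed.

Lemma ae_neq (a : R) : {ae mu, forall x, x != a}.
Proof.
exists [set a]; split; first exact: measurable_set1.
  exact/countable_lebesgue_measure0/countable1.
by move=> x /= /negP; rewrite negbK => /eqP.
Qed.

End Convergence.

Section TestFunctions.
Context {R : realType}.
Implicit Types (f : R -> R) (x : R).

(** The higher derivatives of the test functions have no convenient formula;
    closure of a class under one differentiation makes a formula unnecessary. *)
Lemma smooth_class (S : set (R -> R)) :
  (forall f, S f -> exists2 f', S f' & forall x, is_derive x 1 f (f' x)) ->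
  forall f, S f -> forall n x, derivable (derive1n n f) x 1.
Proof.
move=> Sd f Sf n x.
have: S (derive1n n f).
  elim: n => [//|n /Sd[g Sg gd]]; rewrite derive1nS.
  suff -> : derive1 (derive1n n f) = g by [].
  by apply/funext => y; rewrite derive1E; have [_ ->] := gd y.
by move=> /Sd[g _ gd]; have [] := gd x.
Qed.

Variables (L b : R).
Hypothesis L0 : 0 < L.

(** For [0 < b < L] this is positive on [(0, b)] and negative on [(b, L)].  Each
    factor changes sign under [x -> x + L], so the product is [L]-periodic. *)
Definition bump_arg x : R := sin (pi / L * x) * sin (pi / L * (b - x)).

(** A smooth periodic function that tends, as [n] grows, to the indicator function
    of [[0, b]] almost everywhere on a period. *)
Definition sigmoid (n : nat) x : R := (1 + expR (- n.+1%:R * bump_arg x))^-1.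

(** The functions generated by sines, cosines and [sigmoid n]; closed under
    differentiation because of [s' = (n + 1) t' s (1 - s)] for
    [s = sigmoid n] and [t = bump_arg]. *)
Inductive sigmoid_class (n : nat) : set (R -> R) :=
| SigmoidCst c : sigmoid_class n (fun=> c)
| SigmoidSin a c : sigmoid_class n (fun x => sin (a * x + c))
| SigmoidCos a c : sigmoid_class n (fun x => cos (a * x + c))
| SigmoidSelf : sigmoid_class n (sigmoid n)
| SigmoidAdd f g : sigmoid_class n f -> sigmoid_class n g ->
    sigmoid_class n (fun x => f x + g x)
| SigmoidMul f g : sigmoid_class n f -> sigmoid_class n g ->
    sigmoid_class n (fun x => f x * g x).

Definition bump_arg1 x : R := pi / L * sin (pi / L * (b - 2 * x)).

Lemma is_derive_bump_arg x : is_derive x 1 bump_arg (bump_arg1 x).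
Proof.
rewrite /bump_arg /bump_arg1; der.
have -> : pi / L * (b - 2 * x) = pi / L * (b - x) - pi / L * x by ring.
by rewrite sinB; ring.
Qed.

Lemma sigmoid_den_gt0 n x : 0 < 1 + expR (- n.+1%:R * bump_arg x).
Proof. by rewrite addr_gt0 // expR_gt0. Qed.

Lemma is_derive_sigmoid n x : is_derive x 1 (sigmoid n)
  (n.+1%:R * (bump_arg1 x * (sigmoid n x * (1 + - 1 * sigmoid n x)))).
Proof.
have h := is_derive_bump_arg x; have d0 := lt0r_neq0 (sigmoid_den_gt0 n x).
have H : is_derive x 1 (fun x => 1 + expR (- n.+1%:R * bump_arg x))
   (- n.+1%:R * bump_arg1 x * expR (- n.+1%:R * bump_arg x)) by der; ring.
have H2 := is_deriveVE (f := fun x => 1 + expR (- n.+1%:R * bump_arg x)) d0 H.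
eapply is_derive_eq; first exact: H2.
by rewrite /sigmoid; field.
Qed.

Lemma sigmoid_class_deriv n f : sigmoid_class n f ->
  exists2 f', sigmoid_class n f' & forall x, is_derive x 1 f (f' x).
Proof.
elim=> [c|a c|a c||g h Sg [g' Sg' dg] Sh [h' Sh' dh]|g h Sg [g' Sg' dg] Sh [h' Sh' dh]].
- by exists (fun=> 0); [exact: SigmoidCst|move=> x; exact: is_derive_cstE].
- exists (fun x => a * cos (a * x + c)); last by move=> x; der; ring.
  by apply: SigmoidMul; [exact: SigmoidCst|exact: SigmoidCos].
- exists (fun x => - a * sin (a * x + c)); last by move=> x; der; ring.
  by apply: SigmoidMul; [exact: SigmoidCst|exact: SigmoidSin].
- exists (fun x => n.+1%:R * (bump_arg1 x * (sigmoid n x * (1 + - 1 * sigmoid n x)))).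
    apply: SigmoidMul; first exact: SigmoidCst.
    apply: SigmoidMul; last first.
      apply: SigmoidMul; first exact: SigmoidSelf.
      apply: SigmoidAdd; first exact: SigmoidCst.
      by apply: SigmoidMul; [exact: SigmoidCst|exact: SigmoidSelf].
    have -> : bump_arg1 = (fun x => pi / L * sin (- 2 * (pi / L) * x + pi / L * b)).
      by apply/funext => x; rewrite /bump_arg1; congr (_ * sin _); ring.
    by apply: SigmoidMul; [exact: SigmoidCst|exact: SigmoidSin].
  exact: is_derive_sigmoid.
- exists (fun x => g' x + h' x); first exact: SigmoidAdd.
  by move=> x; exact: is_deriveDE.
- exists (fun x => g' x * h x + g x * h' x); last by move=> x; exact: is_deriveME.
  by apply: SigmoidAdd; apply: SigmoidMul.
Qed.

Lemma sigmoid_continuous n : continuous (sigmoid n).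
Proof. by move=> x; exact: is_derive_continuous (is_derive_sigmoid n x). Qed.

Lemma sigmoid_periodic n x : sigmoid n (x + L) = sigmoid n x.
Proof.
have e : pi / L * L = pi by rewrite divfK // gt_eqF.
rewrite /sigmoid; congr (_ + expR (_ * _))^-1; rewrite /bump_arg.
have -> : pi / L * (x + L) = pi / L * x + pi by rewrite mulrDr e.
have -> : pi / L * (b - (x + L)) = pi / L * (b - x) - pi by rewrite -{3}e; ring.
by rewrite sinDpi sinB cospi sinpi; ring.
Qed.

Lemma sigmoid_bound n x : 0 < sigmoid n x <= 1.
Proof.
rewrite /sigmoid invr_gt0 sigmoid_den_gt0 /= invf_le1 ?sigmoid_den_gt0 //.
by rewrite lerDl expR_ge0.
Qed.

(** The periodic primitive of [sigmoid n] minus its mean. *)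
Definition test_fun n x : R := oint (sigmoid n) x - x / L * oint (sigmoid n) L.

Lemma is_derive_test_fun n x :
  is_derive x 1 (test_fun n) (sigmoid n x + - (oint (sigmoid n) L / L)).
Proof.
have h := is_derive_oint x (@sigmoid_continuous n).
by rewrite /test_fun; der; field; exact: lt0r_neq0.
Qed.

Lemma test_fun_smooth n : smooth_per L (test_fun n).
Proof.
split.
  move=> x.
  have d (z : R) : is_derive z 1 (fun y => test_fun n (y + L) - test_fun n y) 0.
    have h1 : is_derive z 1 (fun y : R => y + L) 1 by der; ring.
    have H := is_deriveDE (is_derive_compE (g := fun y : R => y + L)
      (is_derive_test_fun n (z + L)) h1) (is_deriveNE (is_derive_test_fun n z)).
    eapply is_derive_eq; first exact: H.
    by rewrite sigmoid_periodic; ring.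
  have := is_derive_0_is_cst x 0 d.
  have -> : test_fun n 0 = 0 by rewrite /test_fun oint0 !mul0r subrr.
  have tL : test_fun n L = 0.
    by rewrite /test_fun divff ?gt_eqF // mul1r subrr.
  by rewrite add0r tL subrr => /eqP; rewrite subr_eq0 => /eqP.
pose S := [set f | sigmoid_class n f \/ f = test_fun n].
apply: (smooth_class (S := S)); last by right.
move=> f [/sigmoid_class_deriv[g Sg gd]|->]; first by exists g => //; left.
exists (fun x => sigmoid n x + - (oint (sigmoid n) L / L)); last exact: is_derive_test_fun.
by left; apply: SigmoidAdd; [exact: SigmoidSelf|exact: SigmoidCst].
Qed.

End TestFunctions.

(** * Weak derivatives and primitives *)

Section WeakPrimitive.
Context {R : realType}.
Notation mu := (@lebesgue_measure R).
Implicit Types (f g h : R -> R) (x b : R).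

Lemma integrable_mul_bounded (D : set R) g h (C : R) : measurable D ->
  mu.-integrable D (EFin \o g) -> measurable_fun D h ->
  (forall x, D x -> `|h x| <= C) ->
  mu.-integrable D (EFin \o (fun x => g x * h x)).
Proof.
move=> mD gi mh hC.
have mg : measurable_fun D g by case/integrableP : gi => /measurable_EFinP.
have gC := @integrableZl _ _ _ mu D mD C _ gi.
apply: le_integrable gC => //.
  by apply/measurable_EFinP; exact: measurable_funM mg mh.
move=> x Dx; rewrite /= lee_fin !normrM mulrC ler_wpM2r //.
exact: le_trans (hC x Dx) (ler_norm C).
Qed.

Variable L : R.
Hypothesis L0 : 0 < L.
Notation I := (`[0, L]%classic : set R).
Let mI : measurable I. Proof. exact: measurable_itv. Qed.

Lemma integrable_sub_itv g x : x <= L -> mu.-integrable I (EFin \o g) ->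
  mu.-integrable `[0, x] (EFin \o g).
Proof.
move=> xL; apply: integrableS => //.
by apply: subset_itvl; rewrite bnd_simp.
Qed.

(** Lebesgue differentiation, applied to [g] extended by [0]. *)
Lemma ae_is_derive_Rintegral g : mu.-integrable I (EFin \o g) ->
  {ae mu, forall x, 0 < x < L ->
    is_derive x 1 (fun y => \int[mu]_(t in `[0, y]) g t) (g x)}.
Proof.
move=> gi; pose gI := g \_ I.
have gIi : mu.-integrable setT (EFin \o gI).
  by rewrite -restrict_EFin; apply/integrable_restrict => //; rewrite setTI.
have loc : locally_integrable setT gI by exact: integrable_locally.
have sub y : mu.-integrable [set` Interval (BLeft 0) (BRight y)] (EFin \o gI).
  by apply: integrableS gIi => //; exact: measurable_itv.
apply: ae_imp (FTC1 sub loc) => x /= H /andP[x0 xL].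
have [|dI eI] := H; first by rewrite lte_fin.
have gE y : 0 <= y -> y <= L -> gI y = g y.
  by move=> y0 yL; rewrite /gI patchE mem_set //= in_itv /= y0.
have e : gI x = g x by rewrite gE ?ltW.
have Id : is_derive x 1 (fun y => \int[mu]_(t in `[0, y]) gI t) (g x).
  by rewrite -e -eI derive1E; exact: derivableP.
apply: near_eq_is_derive Id => //; near=> y.
apply: eq_Rintegral => t; rewrite inE /= in_itv /= => /andP[t0 ty].
rewrite gE // (le_trans ty) // ltW //.
by near: y; apply: lt_nbhsl.
Unshelve. all: by end_near. Qed.

Section Identity.
Variable b : R.
Hypothesis b0L : 0 < b < L.
Let ind : R -> R := \1_(`[0, b]).

Let b0 : 0 < b. Proof. by case/andP: b0L. Qed.
Let bL : b < L. Proof. by case/andP: b0L. Qed.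

Lemma logistic_le (y : R) : y < 0 -> (1 + expR (- y))^-1 <= (- y)^-1.
Proof.
move=> y0; rewrite lef_pV2 ?posrE ?oppr_gt0 // ?addr_gt0 ?expR_gt0 //.
have := expR_ge1Dx (- y); lra.
Qed.

Lemma logistic_opp (y : R) : 1 - (1 + expR (- y))^-1 = (1 + expR y)^-1.
Proof.
have e0 := expR_gt0 y; rewrite expRN; field.
by rewrite !gt_eqF ?addr_gt0.
Qed.

Lemma sigmoid_cvg x : bump_arg L b x != 0 ->
  sigmoid L b n x @[n --> \oo] --> (((0 < bump_arg L b x)%R)%:R : R).
Proof.
set t := bump_arg L b x => t0; set l : R := _%:R.
have n0 (n : nat) : 0 < n.+1%:R :> R by [].
have bnd n : `|sigmoid L b n x - l| <= `|t|^-1 * harmonic n.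
  rewrite /sigmoid -/t /harmonic /= -invfM mulNr.
  rewrite -(gtr0_norm (n0 n)) -normrM (gtr0_norm (n0 n)) mulrC /l.
  have y0 : (t * n.+1%:R < 0) = (t < 0) by rewrite pmulr_llt0.
  case: (ltgtP 0 t) t0 => // [tp|tn] _.
    have tn := mulr_gt0 tp (n0 n).
    have h : 0 <= (1 + expR (t * n.+1%:R))^-1.
      by rewrite invr_ge0 addr_ge0 // expR_ge0.
    rewrite distrC logistic_opp (gtr0_norm tn) (ger0_norm h).
    have := @logistic_le (- (t * n.+1%:R)).
    by rewrite !opprK oppr_lt0; apply.
  have h : 0 <= (1 + expR (- (t * n.+1%:R)))^-1.
    by rewrite invr_ge0 addr_ge0 // expR_ge0.
  rewrite mulr0n subr0 (ger0_norm h).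
  by rewrite ltr0_norm ?y0 // logistic_le // y0.
apply/subr_cvg0/norm_cvg0P.
apply: (@squeeze_cvgr _ _ _ _ (fun=> 0) (fun n => `|t|^-1 * harmonic n)).
- by apply: nearW => n; rewrite normr_ge0 /= bnd.
- exact: cvg_cst.
- rewrite -(mulr0 `|t|^-1); apply: cvgMr; exact: cvg_harmonic.
Qed.

Lemma bump_arg_neq0 x : 0 < x < L -> x != b -> bump_arg L b x != 0 /\
  (0 < bump_arg L b x) = (x <= b).
Proof.
move=> /andP[x0 xL] xb; rewrite /bump_arg.
have p0 := pi_gt0 R.
have pl (y : R) : 0 < y -> y < L -> 0 < sin (pi / L * y).
  move=> y0 yL; apply: sin_gt0_pi; rewrite mulr_gt0 ?divr_gt0 //=.
  by rewrite mulrAC ltr_pdivrMr // ltr_pM2l.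
have s1 := pl x x0 xL; move: xb; rewrite neq_lt => /orP[xb|xb].
  have s2 : 0 < sin (pi / L * (b - x)) by apply: pl; [rewrite subr_gt0|have := bL; lra].
  by rewrite mulf_neq0 ?gt_eqF // mulr_gt0 // ltW.
have s2 : 0 < sin (pi / L * (x - b)) by apply: pl; [rewrite subr_gt0|have := b0; lra].
have e : sin (pi / L * (b - x)) = - sin (pi / L * (x - b)).
  by rewrite -sinN -mulrN opprB.
rewrite e mulf_neq0 ?oppr_eq0 ?gt_eqF // mulrN oppr_gt0.
by rewrite ltNge ltW ?mulr_gt0 // leNgt xb.
Qed.

Lemma ae_sigmoid_cvg : {ae mu, forall x, I x ->
  sigmoid L b n x @[n --> \oo] --> ind x}.
Proof.
apply: ae_imp (ae_and (ae_neq 0) (ae_and (ae_neq b) (ae_neq L))) => x.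
move=> /= [x0 [xb xL]]; rewrite in_itv /= => /andP[x0' xL'].
have xI : 0 < x < L by rewrite !lt_neqAle eq_sym x0 x0' xL xL'.
have [t0 tE] := bump_arg_neq0 xI xb.
have -> : ind x = ((0 < bump_arg L b x)%R)%:R.
  by rewrite tE /ind indicE; congr (_ %:R); congr nat_of_bool;
     apply/idP/idP; rewrite inE /= in_itv /= x0'.
exact: sigmoid_cvg.
Qed.

Lemma sigmoid_norm_le n x : `|sigmoid L b n x| <= 1.
Proof. by have /andP[h1 h2] := sigmoid_bound L b n x; rewrite gtr0_norm. Qed.

Lemma measurable_sigmoid n (D : set R) : measurable D -> measurable_fun D (sigmoid L b n).
Proof.
move=> mD; apply: measurable_funTS; apply: continuous_measurable_fun.
exact: sigmoid_continuous.
Qed.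

Let mind (D : set R) : measurable_fun D ind.
Proof. exact: measurable_indic. Qed.

Lemma Rintegral_mul_indic g x : 0 <= x ->
  \int[mu]_(t in `[0, x]) (g t * ind t) = \int[mu]_(t in `[0, Order.min x b]) g t.
Proof.
move=> x0.
have -> : `[0, Order.min x b]%classic = `[0, x]%classic `&` `[0, b]%classic :> set R.
  apply/seteqP; split=> t /=; rewrite !in_itv /= le_min.
    by case/and3P => -> -> ->.
  by case=> /andP[-> ->] /andP[_ ->].
rewrite Rintegral_mkcondr; apply: eq_Rintegral => t _.
by rewrite /ind patchE indicE; case: ifP => _; rewrite ?mulr1 ?mulr0.
Qed.

Lemma integrable_cst (c x : R) : mu.-integrable `[0, x] (EFin \o (fun=> c)).
Proof. by apply: continuous_integrable_itv; exact: cst_continuous. Qed.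

Lemma Rintegral_one x : 0 <= x -> \int[mu]_(t in `[0, x]) 1 = x.
Proof.
move=> x0; have d (t : R) : is_derive t 1 (fun y => oint (fun=> 1) y - y) 0.
  have h := is_derive_oint t (@cst_continuous R R 1).
  by der; ring.
have := is_derive_0_is_cst x 0 d.
by rewrite oint0 subrr /oint x0 => /eqP; rewrite subr_eq0 => /eqP.
Qed.

Lemma oint_sigmoid_cvg x : 0 <= x <= L ->
  oint (sigmoid L b n) x @[n --> \oo] --> Order.min x b.
Proof.
move=> /andP[x0 xL].
have := @Rintegral_mul_cvg R `[0, x] (fun=> 1) (sigmoid L b) ind 1
  (measurable_itv _) (integrable_cst 1 x)
  (fun n => measurable_sigmoid n (measurable_itv _)) (@mind _)
  (fun n t _ => sigmoid_norm_le n t).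
have -> : (fun n => \int[mu]_(t in `[0, x]) (1 * sigmoid L b n t)) =
    (fun n => oint (sigmoid L b n) x).
  apply/funext => n; rewrite /oint x0; apply: eq_Rintegral => t _.
  by rewrite mul1r.
rewrite Rintegral_mul_indic // Rintegral_one; last by rewrite le_min x0 ltW.
apply; apply: ae_imp ae_sigmoid_cvg => t H; rewrite /= in_itv /= => /andP[t0 tx].
by apply: H; rewrite /= in_itv /= t0 (le_trans tx xL).
Qed.

Lemma oint_sigmoid_bound n x : 0 <= x -> 0 <= oint (sigmoid L b n) x <= x.
Proof.
move=> x0; apply/andP; split.
  rewrite -[leLHS](oint0 (sigmoid L b n)).
  apply: (is_derive_nondecreasing (f := oint (sigmoid L b n)) x0) => t _.
    by apply: is_derive_oint; exact: sigmoid_continuous.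
  by have /andP[/ltW] := sigmoid_bound L b n t.
rewrite -subr_ge0.
have := is_derive_nondecreasing (f := fun t => t - oint (sigmoid L b n) t)
  (df := fun t => 1 - sigmoid L b n t) x0.
rewrite oint0 subr0; apply => t _.
  apply: is_deriveDE (is_derive_idE t) (is_deriveNE _).
  by apply: is_derive_oint; exact: sigmoid_continuous.
by have /andP[_] := sigmoid_bound L b n t; rewrite subr_ge0.
Qed.

(** The limit of [test_fun]: it vanishes at [0] and [L], and has slope [1 - b/L]
    before [b] and [- b/L] after it. *)
Definition tent x : R := Order.min x b - x / L * b.

Lemma test_fun_cvg x : 0 <= x <= L -> test_fun L b n x @[n --> \oo] --> tent x.
Proof.
move=> xL; rewrite /test_fun /tent; apply: cvgB; first exact: oint_sigmoid_cvg.
apply: cvgMr.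
have LL : 0 <= L <= L by rewrite ltW //= lexx.
by have := oint_sigmoid_cvg LL; rewrite (min_r (ltW bL)).
Qed.

Lemma test_fun_bound n x : 0 <= x <= L -> `|test_fun L b n x| <= L.
Proof.
move=> /andP[x0 xL]; rewrite /test_fun.
have /andP[h1 h2] := oint_sigmoid_bound n x0.
have /andP[h3 h4] := oint_sigmoid_bound n (ltW L0).
have q0 : 0 <= x / L by rewrite divr_ge0 // ltW.
have q1 : x / L <= 1 by rewrite ler_pdivrMr // mul1r.
have h5 : 0 <= x / L * oint (sigmoid L b n) L <= L.
  by apply/andP; split; [exact: mulr_ge0|exact: le_trans (ler_piMl h3 q1) h4].
by rewrite ler_norml; lra.
Qed.

Lemma measurable_tent (D : set R) : measurable_fun D tent.
Proof.
apply: measurable_funTS; apply: continuous_measurable_fun => x.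
apply: cvgB; last by apply: cvgMl; apply: cvgMl; exact: cvg_id.
by apply: continuous_min; [exact: cvg_id|exact: cvg_cst].
Qed.

(** The limit, by dominated convergence, of the definition of the weak derivative
    tested on [test_fun]. *)
Lemma weak_identity f f1 : mu.-integrable I (EFin \o f) ->
  mu.-integrable I (EFin \o f1) -> weak_deriv L f f1 ->
  \int[mu]_(x in I) (f x * (ind x - b / L)) = - \int[mu]_(x in I) (f1 x * tent x).
Proof.
move=> fi f1i wd.
have LL : 0 <= L <= L by rewrite ltW //= lexx.
have hm : oint (sigmoid L b n) L / L @[n --> \oo] --> b / L.
  by apply: cvgMl; have := oint_sigmoid_cvg LL; rewrite (min_r (ltW bL)).
have c1 := @Rintegral_mul_cvg R I f
  (fun n x => sigmoid L b n x + - (oint (sigmoid L b n) L / L))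
  (fun x => ind x - b / L) 2 mI fi.
have {}c1 : \int[mu]_(x in I) (f x * (sigmoid L b n x + - (oint (sigmoid L b n) L / L)))
    @[n --> \oo] --> \int[mu]_(x in I) (f x * (ind x - b / L)).
  apply: c1 => [n||n x Ix|].
  - by apply: measurable_funD => //; exact: measurable_sigmoid.
  - by apply: measurable_funB => //; exact: mind.
  - rewrite (le_trans (ler_normB _ _)) // lerD ?sigmoid_norm_le //.
    have /andP[h3 h4] := oint_sigmoid_bound n (ltW L0).
    by rewrite ger0_norm ?divr_ge0 ?(ltW L0) // ler_pdivrMr // mul1r.
  - apply: ae_imp ae_sigmoid_cvg => x H Ix; apply: cvgB => //; exact: H.
have {}c2 : \int[mu]_(x in I) (f1 x * test_fun L b n x)
    @[n --> \oo] --> \int[mu]_(x in I) (f1 x * tent x).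
  apply: (@Rintegral_mul_cvg R I f1 (test_fun L b) tent L mI f1i).
  - move=> n; apply: measurable_funTS; apply: continuous_measurable_fun => x.
    exact: is_derive_continuous (is_derive_test_fun b L0 n x).
  - exact: measurable_tent.
  - by move=> n x; rewrite /= in_itv /=; exact: test_fun_bound.
  - by apply: aeW => x; rewrite /= in_itv /=; exact: test_fun_cvg.
have e n : \int[mu]_(x in I) (f x * (sigmoid L b n x + - (oint (sigmoid L b n) L / L)))
    = - \int[mu]_(x in I) (f1 x * test_fun L b n x).
  rewrite -(wd _ (test_fun_smooth b L0 n)); apply: eq_Rintegral => x _.
  by rewrite derive1E; have [_ ->] := is_derive_test_fun b L0 n x.
have c3 : \int[mu]_(x in I) (f x * (sigmoid L b n x + - (oint (sigmoid L b n) L / L)))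
    @[n --> \oo] --> - \int[mu]_(x in I) (f1 x * tent x).
  by rewrite (eq_cvg _ _ e); exact: cvgN.
exact: cvg_unique c1 c3.
Qed.

Let ind_le1 x : `|ind x| <= 1.
Proof. by rewrite /ind indicE; case: (x \in _); rewrite ?normr1 ?normr0. Qed.

Lemma integrable_scale (D : set R) (c : R) g : measurable D ->
  mu.-integrable D (EFin \o g) -> mu.-integrable D (EFin \o (fun x => c * g x)).
Proof. by move=> mD gi; exact: (@integrableZl _ _ _ mu D mD c _ gi). Qed.

Lemma integrable_sub (D : set R) g h : measurable D ->
  mu.-integrable D (EFin \o g) -> mu.-integrable D (EFin \o h) ->
  mu.-integrable D (EFin \o (fun x => g x - h x)).
Proof. by move=> mD gi hi; exact: (@integrableB _ _ _ mu D mD _ _ gi hi). Qed.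

Lemma integrable_mulx f1 : mu.-integrable I (EFin \o f1) ->
  mu.-integrable I (EFin \o (fun x => f1 x * x)).
Proof.
move=> f1i; apply: (integrable_mul_bounded (C := L)) => //.
by move=> x; rewrite /= in_itv /= => /andP[x0 xL]; rewrite ger0_norm.
Qed.

(** On [[0, L]] the minimum of [x] and [b] is [x] times the indicator of [[0, b]]
    plus [b] times its complement, which expresses both integrals by
    primitives evaluated at [b] and [L]. *)
Lemma weak_identity_primitives f f1 : mu.-integrable I (EFin \o f) ->
  mu.-integrable I (EFin \o f1) -> weak_deriv L f f1 ->
  \int[mu]_(x in I) f1 x = 0 ->
  let A y := \int[mu]_(x in `[0, y]) f x in
  let B y := \int[mu]_(x in `[0, y]) f1 x in
  let C y := \int[mu]_(x in `[0, y]) (f1 x * x) in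
  A b - b / L * A L = - (C b - b * B b - b / L * C L).
Proof.
move=> fi f1i wd f10 A B C.
have := weak_identity fi f1i wd.
have Li := fun g => @Rintegral_mul_indic g L (ltW L0).
have indi g : mu.-integrable I (EFin \o g) ->
    mu.-integrable I (EFin \o (fun x => g x * ind x)).
  by move=> gi; apply: (integrable_mul_bounded (C := 1)) => //; exact: mind.
have g1i := integrable_mulx f1i.
have bmin : Order.min L b = b by apply/min_r/ltW.
have -> : \int[mu]_(x in I) (f x * (ind x - b / L)) = A b - b / L * A L.
  under eq_Rintegral do rewrite mulrBr [_ * (b / L)]mulrC.
  rewrite RintegralB //; [|exact: indi|exact: integrable_scale].
  by rewrite RintegralZl // Li bmin.
have -> : \int[mu]_(x in I) (f1 x * tent x) = C b - b * B b - b / L * C L => //.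
have -> : \int[mu]_(x in I) (f1 x * tent x) =
  \int[mu]_(x in I) ((f1 x * x * ind x - b * (f1 x * ind x)) +
     (b * f1 x - b / L * (f1 x * x))).
  apply: eq_Rintegral => x; rewrite inE /= in_itv /= => /andP[x0 xL].
  have -> : ind x = (x <= b)%R%:R.
    rewrite /ind indicE; congr (_ %:R); congr nat_of_bool.
    by apply/idP/idP; rewrite inE /= in_itv /= x0.
  rewrite /tent; case: leP => xb; rewrite ?mulr1n ?mulr0n; ring.
rewrite RintegralD //; last 2 first.
- by apply: integrable_sub => //; [exact: indi|apply: integrable_scale => //; exact: indi].
- by apply: integrable_sub => //; [exact: integrable_scale|exact: integrable_scale].
rewrite RintegralB //; [|exact: indi|apply: integrable_scale => //; exact: indi].
rewrite RintegralB //; [|exact: integrable_scale|exact: integrable_scale].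
rewrite !RintegralZl //; last exact: indi.
by rewrite f10 (Li (fun x => f1 x * x)) Li bmin; rewrite mulr0 sub0r.
Qed.

End Identity.

(** Test with the constant function [1]. *)
Lemma weak_deriv_mean0 f f1 : weak_deriv L f f1 -> \int[mu]_(x in I) f1 x = 0.
Proof.
have S : smooth_per L (fun=> 1 : R).
  split => //; apply: (smooth_class (S := [set g | exists c, g = (fun=> c)])); last by exists 1.
  move=> g [c ->]; exists (fun=> 0); first by exists 0.
  by move=> x; exact: is_derive_cstE.
move=> /(_ _ S).
under eq_Rintegral do rewrite derive1_cst mulr0.
rewrite (Rintegral_cst mu mI) mul0r => /esym/eqP; rewrite oppr_eq0 => /eqP e.
rewrite -[RHS]e; by apply: eq_Rintegral => x _; rewrite mulr1.
Qed.

(** The identity between primitives holds for every [b], and each primitive is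
    differentiable at almost every [b] with the expected derivative.  On
    differentiating, the terms [b f1(b)] cancel, and [f(b)] is left equal to a
    constant plus the integral of [f1] over [[0, b]]. *)
Lemma weak_primitive f f1 : mu.-integrable I (EFin \o f) ->
  mu.-integrable I (EFin \o f1) -> weak_deriv L f f1 ->
  exists C, f = (fun x => C + \int[mu]_(t in `[0, x]) f1 t) %[ae mu in I].
Proof.
move=> fi f1i wd.
have f10 := weak_deriv_mean0 wd; have g1i := integrable_mulx f1i.
pose A y := \int[mu]_(x in `[0, y]) f x.
pose B y := \int[mu]_(x in `[0, y]) f1 x.
pose C y := \int[mu]_(x in `[0, y]) (f1 x * x).
exists ((A L + C L) / L).
apply: ae_imp (ae_and (ae_and (ae_neq 0) (ae_neq L)) (ae_and (ae_is_derive_Rintegral fi)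
  (ae_and (ae_is_derive_Rintegral f1i) (ae_is_derive_Rintegral g1i)))) => x /=.
move=> [[xn0 xnL] [dA [dB dC]]]; rewrite in_itv /= => /andP[x0 xL].
have xI : 0 < x < L by rewrite !lt_neqAle eq_sym xn0 x0 xnL xL.
have {}dA : is_derive x 1 A (f x) := dA xI.
have {}dB : is_derive x 1 B (f1 x) := dB xI.
have {}dC : is_derive x 1 C (f1 x * x) := dC xI.
pose G y : R := A y - y / L * A L + (C y - y * B y - y / L * C L).
have G0 y : 0 < y < L -> G y = 0.
  move=> yI; rewrite /G (weak_identity_primitives yI fi f1i wd f10).
  by rewrite -/(B y) -/(C y) -/(C L) addNr.
have dG : is_derive x 1 G (f x - A L / L - B x - C L / L) by rewrite /G; der; ring.
have := is_derive_locally0 xI G0 dG.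
rewrite -/(B x) mulrDl; lra.
Qed.

End WeakPrimitive.

(** * Classical and weak solutions *)

Section Sobolev.
Context {R : realType}.
Notation mu := (@lebesgue_measure R).
Implicit Types (f g u p : R -> R) (x : R).

Variable L : R.
Hypothesis L0 : 0 < L.
Notation I := (`[0, L]%classic : set R).
Let mI : measurable I. Proof. exact: measurable_itv. Qed.

Lemma continuous_Lfun2 g : continuous g -> g \_ I \in Lfun mu 2%:E.
Proof.
move=> gc.
have mg : measurable_fun setT g by exact: continuous_measurable_fun.
have mgI : measurable_fun setT (g \_ I).
  by apply/(measurable_restrictT _ _).1 => //; exact: measurable_funTS.
rewrite inE; apply/andP; split; rewrite inE //=.
rewrite /finite_norm unlock /Lnorm; apply: poweR_lty.
have g2 : continuous (fun x => g x ^+ 2).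
  by move=> x; apply: cvgM; exact: gc.
have /integrableP[_] := continuous_integrable_itv 0 L g2.
apply: le_lt_trans; rewrite [leRHS]integral_mkcond; apply: ge0_le_integral => //.
- by move=> x _; exact: poweR_ge0.
- apply/measurable_EFinP.
  apply/(@measurableT_comp _ _ _ _ _ _ (fun x : R => x `^ 2)%R) => //.
  exact/measurableT_comp.
- apply/(measurable_restrictT _ _).1 => //; apply: measurable_funTS.
  apply: measurableT_comp => //; apply/measurable_EFinP.
  exact: continuous_measurable_fun.
- move=> x _; rewrite /= !patchE; case: ifP => _.
    by rewrite lee_fin powR_mulrn // normrX.
  by rewrite normr0 powR0.
Qed.

Lemma L2per_integrable f : L2per L f -> mu.-integrable I (EFin \o f).
Proof.
move=> [_ fL].
have h := Lfun2_mul_Lfun1 fL (continuous_Lfun2 (@cst_continuous R R 1)).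
have : mu.-integrable setT (EFin \o (f \_ I)).
  apply/Lfun1_integrable.
  have e : f \_ I = (f \_ I) \* ((fun=> 1 : R) \_ I) :> (R -> R).
    by apply/funext => x /=; rewrite !patchE; case: ifP => _; rewrite ?mulr1 ?mulr0.
  by rewrite e.
rewrite -restrict_EFin => fI; rewrite -[X in mu.-integrable X]setTI.
by apply/integrable_restrict.
Qed.

Lemma continuous_L2per f : periodic f L -> continuous f -> L2per L f.
Proof. by move=> fp fc; split => //; exact: continuous_Lfun2. Qed.

Lemma weak_deriv_classical f f1 : periodic f L ->
  (forall x, is_derive x 1 f (f1 x)) -> continuous f1 -> weak_deriv L f f1.
Proof.
move=> fp fd f1c phi [pp ps].
have pd x : is_derive x 1 phi (derive1 phi x).
  by rewrite derive1E; apply: derivableP; exact: (ps 0%N).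
have pc : continuous (derive1 phi).
  move=> x; have := ps 1%N x; rewrite derive1n1 => h.
  by apply: differentiable_continuous; exact/derivable1_diffP.
have oo g g1 : (forall x, is_derive x 1 g (g1 x)) -> derivable_oo_LRcontinuous g 0 L.
  move=> gd; split; first by move=> x _; have [] := gd x.
    by apply: cvg_at_right_filter; exact: is_derive_continuous (gd 0).
  by apply: cvg_at_left_filter; exact: is_derive_continuous (gd L).
rewrite (@Rintegration_by_parts R f phi f1 (derive1 phi) 0 L L0).
- have <- : f L = f 0 by rewrite -[L]add0r fp.
  have <- : phi L = phi 0 by rewrite -[L]add0r pp.
  by rewrite subrr sub0r.
- exact: continuous_subspaceT.
- exact: oo fd.
- by move=> x _; rewrite derive1E; have [_ ->] := fd x.
- exact: continuous_subspaceT.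
- exact: oo pd.
- by [].
Qed.

Lemma H2per_classical f f1 f2 :
  periodic f L -> periodic f1 L -> periodic f2 L ->
  (forall x, is_derive x 1 f (f1 x)) -> (forall x, is_derive x 1 f1 (f2 x)) ->
  continuous f2 -> H2per L f f1 f2.
Proof.
move=> fp f1p f2p fd f1d f2c.
have fc : continuous f by move=> x; exact: is_derive_continuous (fd x).
have f1c : continuous f1 by move=> x; exact: is_derive_continuous (f1d x).
by split; try exact: continuous_L2per; exact: weak_deriv_classical.
Qed.

(** Projection of the line onto [[0, L]]; composing with it extends a function that
    is continuous on the period to a continuous function on the line. *)
Definition clamp x : R := Order.max 0 (Order.min x L).

Lemma clamp_itv x : 0 <= clamp x <= L.
Proof. by rewrite /clamp le_max lexx /= ge_max ltW //= ge_min lexx orbT. Qed.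

Lemma clamp_id x : 0 <= x <= L -> clamp x = x.
Proof. by move=> /andP[x0 xL]; rewrite /clamp min_l // max_r. Qed.

Lemma clamp_continuous : continuous clamp.
Proof.
move=> x; have -> : clamp = (fun=> 0 : R) \max (id \min (fun=> L)) by [].
apply: continuous_max; first exact: cvg_cst.
by apply: continuous_min; [exact: cvg_id|exact: cvg_cst].
Qed.

Lemma continuous_comp_clamp g : {within I, continuous g} ->
  continuous (fun x => g (clamp x)).
Proof.
move=> /subspace_continuousP gc x.
have Ix : I (clamp x) by rewrite /= in_itv; exact: clamp_itv.
apply: cvg_comp (gc _ Ix) => U /= wU.
have H : \forall y \near x, I (clamp y) -> U (clamp y) := @clamp_continuous x _ wU.
near=> y; have : I (clamp y) by rewrite /= in_itv; exact: clamp_itv.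
by near: y.
Unshelve. all: by end_near.
Qed.

(** By [weak_primitive], [f1] is almost everywhere the continuous function [F1], so
    [f] is almost everywhere the continuously differentiable function [u].  Then
    [f2 = p u] almost everywhere, hence [F1] is on the period the primitive
    [u1] of a continuous function.  The boundary conditions say that weak
    derivatives have mean zero. *)
Lemma H2per_ode f f1 f2 p : continuous p -> H2per L f f1 f2 ->
  f2 = (fun x => p x * f x) %[ae mu in I] ->
  exists u u1, [/\ solves p u u1 0 L, u 0 = u L, u1 0 = u1 L & f = u %[ae mu in I]].
Proof.
move=> pc [fL f1L f2L wd1 wd2] f2E.
have fi := L2per_integrable fL; have f1i := L2per_integrable f1L.
have f2i := L2per_integrable f2L.
have [C0 fE] := weak_primitive L0 fi f1i wd1.
have [C1 f1E] := weak_primitive L0 f1i f2i wd2.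
pose F1 x := C1 + \int[mu]_(t in `[0, x]) f2 t.
have F1w : {within I, continuous F1}.
  have := parameterized_integral_continuous (ltW L0) f2i => h x.
  by apply: cvgD; [exact: cvg_cst|exact: h].
have F1c := continuous_comp_clamp F1w.
pose u x := C0 + oint (fun y => F1 (clamp y)) x.
have du x : is_derive x 1 u (F1 (clamp x)).
  have h := is_derive_oint x F1c.
  by rewrite /u; eapply is_derive_eq; [exact: is_deriveDE (is_derive_cstE _ _) h|rewrite add0r].
have uc : continuous u by move=> x; exact: is_derive_continuous (du x).
have puc : continuous (fun x => p x * u x) by move=> x; apply: cvgM; [exact: pc|exact: uc].
pose u1 x := C1 + oint (fun y => p y * u y) x.
have du1 x : is_derive x 1 u1 (p x * u x).
  have h := is_derive_oint x puc.
  by rewrite /u1; eapply is_derive_eq; [exact: is_deriveDE (is_derive_cstE _ _) h|rewrite add0r].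
have mS g x : x <= L -> mu.-integrable I (EFin \o g) -> measurable_fun `[0, x] g.
  by move=> xL gi; have /integrableP[/measurable_EFinP] := integrable_sub_itv xL gi.
have mC g (D : set R) : continuous g -> measurable_fun D g.
  by move=> gc; apply: measurable_funTS; exact: continuous_measurable_fun.
have sub (P : set R) x : x <= L -> {ae mu, forall y, I y -> P y} ->
    {ae mu, forall y, `[0, x]%classic y -> P y}.
  move=> xL; apply: ae_imp => y H /=; rewrite in_itv /= => /andP[y0 yx].
  by apply: H; rewrite /= in_itv /= y0 (le_trans yx).
have uE x : 0 <= x <= L -> u x = C0 + \int[mu]_(t in `[0, x]) f1 t.
  move=> /andP[x0 xL]; rewrite /u /oint x0; congr (_ + _).
  apply: Rintegral_ae_eq => //; [exact: mC|exact: mS|].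
  by apply: sub => //; apply: ae_imp f1E => y H Iy; rewrite H // /F1 clamp_id.
have fu : f = u %[ae mu in I].
  by apply: ae_imp fE => x H Ix; rewrite H // uE.
have u1E x : 0 <= x <= L -> u1 x = F1 x.
  move=> /andP[x0 xL]; rewrite /u1 /F1 /oint x0; congr (_ + _).
  apply: Rintegral_ae_eq => //; [exact: mC|exact: mS|].
  apply: sub => //; apply: ae_imp (ae_and fu f2E) => y [H1 H2] Iy.
  by rewrite H2 // H1.
have I0 : 0 <= (0 : R) <= L by rewrite lexx ltW.
have IL : 0 <= L <= L by rewrite lexx ltW.
exists u, u1; split => //.
- move=> x xL; split; last exact: du1.
  by rewrite u1E // -{2}(clamp_id xL); exact: du.
- by rewrite !uE // (weak_deriv_mean0 wd1) set_itv1 Rintegral_set1.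
- by rewrite !u1E // /F1 (weak_deriv_mean0 wd2) set_itv1 Rintegral_set1.
Qed.

(** All integrals of [f] over [[0, x]] vanish, so [f] vanishes on [(0, L)], and at
    [0] by continuity. *)
Lemma continuous_ae0 f : continuous f -> f = (fun=> 0) %[ae mu in I] -> f 0 = 0.
Proof.
move=> fc f0.
have Fz x : 0 < x < L -> oint f x = 0.
  move=> /andP[x0 xL]; rewrite /oint ltW //.
  transitivity (\int[mu]_(t in `[0, x]) (0 : R)).
    apply: Rintegral_ae_eq => //.
      by apply: measurable_funTS; exact: continuous_measurable_fun.
    apply: ae_imp f0 => y H /=; rewrite in_itv /= => /andP[y0 yx].
    by apply: H; rewrite /= in_itv /= y0 (le_trans yx) // ltW.
  by rewrite (Rintegral_cst mu (measurable_itv _)) mul0r.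
have fz x : 0 < x < L -> f x = 0.
  by move=> xL; exact: is_derive_locally0 xL Fz (is_derive_oint x fc).
apply: contrapT => /eqP fn.
have fr : f x @[x --> 0^'+] --> f 0 by apply: cvg_at_right_filter; exact: fc.
near (0 : R)^'+ => y.
have : f y != 0 by near: y; exact: (cvgr_neq0 (f 0) fr fn).
rewrite fz ?eqxx //; apply/andP; split.
  by near: y; exact: nbhs_right_gt.
by near: y; exact: nbhs_right_lt.
Unshelve. all: by end_near. Qed.

End Sobolev.

(** * The spectrum of the linearized operator *)

Section Spectrum.
Context {R : realType}.
Implicit Types (f : R -> R) (x lam : R).
Variables (L k : R).
Hypotheses (L0 : 0 < L) (k01 : 0 < k < 1) (mt0 : 0 < mtilde L k).

Let K := ellipK k.
Let w := 2 * K / L.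
Let m := k ^+ 2.
Let r := Num.sqrt (m ^+ 2 - m + 1).
Let sn := per_sn k L.
Let cn := per_cn k L.
Let dn := per_dn k L.

(** The ratio between a change of the eigenvalue and the change of the spectral
    parameter of the Lame equation. *)
Definition energy_scale := 4 * ellipK k ^+ 2 / mtilde L k.
Let kap := energy_scale.

Let m01 : 0 < m < 1.
Proof. by case/andP: k01 => k0 k1; rewrite exprn_gt0 //= exprn_ilt1 // ltW. Qed.
Let q0 : 0 < m ^+ 2 - m + 1.
Proof. by have := sqr_ge0 m; case/andP: m01; lra. Qed.
Let r0 : 0 < r. Proof. by rewrite sqrtr_gt0. Qed.
Let rE : r ^+ 2 = m ^+ 2 - m + 1. Proof. by rewrite sqr_sqrtr // ltW. Qed.
Let K0 : 0 < K. Proof. exact: ellipK_gt0. Qed.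
Let kap0 : 0 < kap.
Proof. by rewrite divr_gt0 // mulr_gt0 // exprn_gt0. Qed.
Let w0 : 0 < w. Proof. exact: per_freq_gt0. Qed.
Let J : jacobi_triple w m sn cn dn. Proof. exact: per_jacobi. Qed.
Let c0 : 0 < wave_speed L k. Proof. by rewrite divr_gt0 // exprn_gt0. Qed.

Let speedE : wave_speed L k * w ^+ 2 = kap.
Proof.
rewrite /wave_speed /w /kap /energy_scale -/K; field.
by rewrite !gt_eqF.
Qed.

Let mtE : L ^+ 2 - mtilde L k = 64 * K ^+ 2 * r.
Proof. by rewrite /mtilde /r /m -exprM -/K; ring. Qed.

Let speed1E : wave_speed L k - 1 = 16 * kap * r.
Proof.
have n0 : mtilde L k != 0 by rewrite gt_eqF.
rewrite /wave_speed -[X in _ - X](divff n0) -mulrBl mtE /kap /energy_scale -/K.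
by field.
Qed.

(** The expression inside the square of the profile is positive, so the square
    root is that expression, written here in terms of [sn]. *)
Lemma sqrt_wave_profile x : Num.sqrt (wave_profile L k x) =
  20 / 3 * kap * (r + 1 + m - 3 * m * sn x ^+ 2).
Proof.
have n0 : mtilde L k != 0 by rewrite gt_eqF.
have -> : wave_profile L k x = (20 / 3 * kap * (r + 1 + m - 3 * m * sn x ^+ 2)) ^+ 2.
  rewrite /wave_profile; congr (_ ^+ 2).
  have -> : jacobi_cn (2 * ellipK k / L * x) k ^+ 2 = 1 - sn x ^+ 2.
    by rewrite -(cn_sqr J).
  have L2 : L ^+ 2 = mtilde L k + 64 * K ^+ 2 * r by rewrite -mtE; ring.
  by rewrite L2 /kap /energy_scale -/K -/m; field.
rewrite sqrtr_sqr ger0_norm //; apply: mulr_ge0.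
  by rewrite mulr_ge0 ?(ltW kap0) // divr_ge0.
have r2 : 2 * m - 1 < r by move: m01 r0 rE => /andP[m0 m1] h1 h2; nra.
have : m * sn x ^+ 2 <= m.
  case/andP: m01 => m0 _; rewrite ger_pMr //.
  by have := sqr_ge0 (cn x); rewrite (cn_sqr J) subr_ge0.
by move: r2; lra.
Qed.

Definition spectral_param lam := lame_edge m r + lam / kap.

Lemma operator_eqE (lam f2 f x : R) :
  (lam * f = - wave_speed L k * f2 + (wave_speed L k - 1) * f
     - 3 / 2 * Num.sqrt (wave_profile L k x) * f) <->
  (f2 = lame_pot w m sn (spectral_param lam) x * f).
Proof.
rewrite sqrt_wave_profile speed1E.
have n1 : kap != 0 by rewrite gt_eqF.
have n2 : wave_speed L k != 0 by rewrite gt_eqF.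
have e : wave_speed L k * (lame_pot w m sn (spectral_param lam) x * f) =
    16 * kap * r * f - 3 / 2 * (20 / 3 * kap * (r + 1 + m - 3 * m * sn x ^+ 2)) * f
    - lam * f.
  transitivity (wave_speed L k * w ^+ 2 *
    ((30 * m * sn x ^+ 2 - spectral_param lam) * f)); first by rewrite /lame_pot; ring.
  by rewrite speedE /spectral_param /lame_edge; field.
split=> [h|->].
  by apply: (mulfI n2); rewrite e h; ring.
by rewrite mulNr e; ring.
Qed.

Let p_cont h : continuous (lame_pot w m sn h).
Proof.
move=> x; have hs := sn_deriv J x.
have d : is_derive x 1 (lame_pot w m sn h)
    (w ^+ 2 * (60 * m * sn x * (w * (cn x * dn x)))).
  by rewrite /lame_pot; der; ring.
exact: is_derive_continuous d.
Qed.

Lemma spectral_param_lt lam : lam < 0 -> spectral_param lam < lame_edge m r.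
Proof.
by move=> l0; rewrite /spectral_param gtrDl pmulr_llt0 // invr_gt0.
Qed.

Lemma linearized_op_lame lam g : lam < 0 ->
  linearized_op L k g (fun x => lam * g x) -> ~ eq_L2per L g (fun=> 0) ->
  lame_det m (spectral_param lam) = 0 /\
  exists a, eq_L2per L g (fun x => a * lame_ground m sn dn (spectral_param lam) x).
Proof.
move=> l0 [_ [g1 [g2 [gH gE]]]] gn.
have [|u [u1 [S u_per u1_per gu]]] := H2per_ode L0 (@p_cont (spectral_param lam)) gH.
  by apply: ae_imp gE => x H Ix; apply/operator_eqE; exact: H.
have half : 2 * (L / 2) = L by field.
rewrite -half in S u_per u1_per.
have [||D0 [a uE]] := lame_periodic J w0 m01 r0 rE _ (per_sn0 k01 L)
  (per_cn_half k01 L0) (per_sn_gt0 k01 L0) (per_cn_gt0 k01 L0) (per_sn_refl k01 L0)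
  (per_dn_refl k01 L0) (spectral_param_lt l0) S u_per u1_per.
- by rewrite divr_gt0.
- apply: contrapT => un; apply: gn; apply: ae_imp gu => x H Ix; rewrite H //.
  apply: contrapT => /eqP ux; apply: un; exists x => //.
  by rewrite half; move: Ix; rewrite /= in_itv.
split => //; exists a; apply: ae_imp gu => x H Ix; rewrite H // uE // half.
by move: Ix; rewrite /= in_itv.
Qed.

Lemma lame_ground_eigenfunction lam : lame_det m (spectral_param lam) = 0 ->
  eigenfunction L (linearized_op L k) lam (lame_ground m sn dn (spectral_param lam)).
Proof.
move=> D0; set h := spectral_param lam; set f := lame_ground m sn dn h.
pose f1 := lame_ground1 w m sn cn dn h; pose f2 x := lame_pot w m sn h x * f x.
have d1 x : is_derive x 1 f (f1 x) by exact: is_derive_lame_fun.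
have d2 x : is_derive x 1 f1 (f2 x) by exact: is_derive_lame_ground1.
have sns x : sn (x + L) = - sn x by exact: per_sn_shift.
have cns x : cn (x + L) = - cn x by exact: per_cn_shift.
have dns x : dn (x + L) = dn x by exact: per_dn_shift.
have sn0 : sn 0 = 0 by exact: per_sn0.
have even4 x : (- sn x) ^+ 4 = sn x ^+ 4 by ring.
have p0 : periodic f L.
  by move=> x; rewrite /f /lame_ground /lame_fun dns sns sqrrN even4.
have p1 : periodic f1 L.
  by move=> x; rewrite /f1 /lame_ground1 /lame_fun1 dns sns cns sqrrN even4 mulrNN.
have p2 : periodic f2 L by move=> x; rewrite /f2 p0 /lame_pot sns sqrrN.
have fc : continuous f by move=> x; exact: is_derive_continuous (d1 x).
split; last first.
  move=> /(continuous_ae0 L0 fc); rewrite /f /lame_ground /lame_fun sn0.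
  rewrite !expr0n /= !mulr0 !addr0 => /eqP; rewrite mulf_eq0 pnatr_eq0 orbF.
  by rewrite gt_eqF // (dn_gt0 J).
split.
  apply: continuous_L2per; first by move=> x; rewrite p0.
  by move=> x; apply: cvgMr; exact: fc.
have f2c : continuous f2 by move=> x; apply: cvgM; [exact: p_cont|exact: fc].
exists f1, f2; split; first exact: (H2per_classical L0 p0 p1 p2 d1 d2 f2c).
by apply: aeW => x _; apply: (operator_eqE lam (f2 x) (f x) x).2.
Qed.

Theorem linearized_op_negative_spectrum : exists lam : R,
    [/\ lam < 0,
        eigenvalue_of L (linearized_op L k) lam,
        forall lam' : R, lam' < 0 ->
          eigenvalue_of L (linearized_op L k) lam' -> lam' = lam
      & simple_eigenvalue L (linearized_op L k) lam].
Proof.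
have edge0 := lame_edge_gt0 m01 r0 rE.
have Dc (x : R) : {for x, continuous (lame_det m)}.
  suff d : is_derive x 1 (lame_det m)
    (- ((4 + 9 * m - x) * (16 + 25 * m - x) + 216 * m)
     + (m - x) * (2 * x - 20 - 34 * m) - 56 * m) by exact: is_derive_continuous d.
  by rewrite /lame_det; der; ring.
have sgn : lame_det m 0 * lame_det m (lame_edge m r) < 0.
  by rewrite pmulr_rlt0 ?lame_det0_gt0 // lame_det_edge_lt0.
have [h /andP[_ hlt] Dh] := IVT0 (ltW edge0) (fun x _ => Dc x) sgn.
pose lam := kap * (h - lame_edge m r).
have hE : spectral_param lam = h.
  by rewrite /spectral_param /lam; field; exact: lt0r_neq0.
have lam0 : lam < 0 by rewrite /lam pmulr_rlt0 // subr_lt0.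
have ef : eigenfunction L (linearized_op L k) lam (lame_ground m sn dn h).
  by rewrite -hE; apply: lame_ground_eigenfunction; rewrite hE.
exists lam; split => //; first by exists (lame_ground m sn dn h).
- move=> lam' l0 [g [gA gn]]; have [D0 _] := linearized_op_lame l0 gA gn.
  have e : spectral_param lam' = h.
    exact: (lame_det_root_unique m01 r0 rE (spectral_param_lt l0) hlt D0 Dh).
  by rewrite /lam -e /spectral_param; field; exact: lt0r_neq0.
- exists (lame_ground m sn dn h) => // g gA.
  have [g0|gn] := pselect (eq_L2per L g (fun=> 0)).
    by exists 0; apply: ae_imp g0 => x H Ix; rewrite H // mul0r.
  by have [_] := linearized_op_lame lam0 gA gn; rewrite hE.
Qed.

End Spectrum.

Theorem mainTheorem3 (R : realType) (L kL : R) (hL : 4 * pi < L)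
    (hkL : 0 < kL < 1) (hgkL : gfun kL = L ^+ 2)
    (k : R) (hk : 0 < k < kL) :
  exists lam : R,
    [/\ lam < 0,
        eigenvalue_of L (linearized_op L k) lam,
        forall lam' : R, lam' < 0 ->
          eigenvalue_of L (linearized_op L k) lam' -> lam' = lam
      & simple_eigenvalue L (linearized_op L k) lam].
Proof.
case/andP: hk hkL => k0 kkL /andP[_ kL1].
have L0 : 0 < L by apply: lt_trans hL; rewrite mulr_gt0 // pi_gt0.
apply: linearized_op_negative_spectrum => //.
  by rewrite k0 (lt_trans kkL kL1).
have := gfun_lt k0 kkL kL1.
by rewrite hgkL /gfun /mtilde subr_gt0.
Qed.
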